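(* Let the layered medium ($\varepsilon,\sigma,\mu$; $0=z_0<z_1<\dots<z_N=L$; $I_j=[z_{j-1},z_j)$ for $1\le j\le N$, $I_{N+1}=[z_N,\infty)$), the complex frequency $\omega=\omega_1+i\omega_2$ with $\omega_1>0$, $\omega_2\le 0$, and the functions $k_j$, $q$, $u_j$, $w_j$ be as defined in the context. Assume the following two conditions. **Condition A.** There exists a constant $C>0$ such that $$\frac{\sigma(z)}{\varepsilon(z)}\le \frac{2C\omega_1}{\mu_0c^2}\quad\text{for all } z\in[0,L],\qquad -(1+\phi(C))\,\omega_1\le\omega_2\le(1-\sqrt2)\,\omega_1,$$ where $\phi(C)=\sqrt{2+C^2}-C$. **Condition B.** $\delta\in(0,\sqrt2-1]$ is given and, for each $j=1,\dots,N$, there are constants $C_j$ and $\lambda_j$ such that for all $z\in I_j$ $$|\varepsilon_j'(z)|\le 4\lambda_j\frac{|\omega_1\omega_2|}{|\omega|^2}\,\varepsilon_j(z),\qquad |\sigma_j'(z)|\le 2\lambda_j\frac{\omega_1}{|\omega|}\,\sigma_j(z),$$ $$4c^{-1}\sqrt{\frac{\mu\,\varepsilon_j(z)\,\omega_1|\omega_2|}{\sqrt2+1}}-c_0\lambda_j\ \ge\ C_j>0,$$ and $$e^{-C_j(z_j-z_{j-1})}+\frac{\lambda_j}{C_j}\Bigl(1+\frac{\lambda_j}{C_j}\Bigr)\le\delta^2,$$ where $c_0=\tan(3\pi/8)+\sec(3\pi/8)=1+\sqrt2+\sqrt{4+2\sqrt2}$. For the last (homogeneous) layer put $\lambda_{N+1}=0$,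 $C_{N+1}=1$. Then: 1. for every $j=0,1,\dots,N$, $$|w_{j+1}(z_j)|\le\delta,\qquad \sup_{z\in I_{j+1}}|w_{j+1}(z)|\le 1+\frac{\lambda_{j+1}}{C_{j+1}};$$ 2. for every $j=1,\dots,N$, $$\lim_{z\to z_j-0}|w_j(z)|\le 1;$$ 3. for every $j=1,\dots,N$ there is a complex number $\kappa_j$ with $$k_j(z_{j-1})=-i\,q(z_{j-1})\,(1-\kappa_j),\qquad |\kappa_j|\le\frac{2\delta}{1-\delta}.$$
   Context: Constants: $c>0$, $\mu_0>0$, $\mu>0$ are fixed real constants (speed of light, vacuum permeability, relative permeability). Medium: $0=z_0<z_1<\dots<z_N=L$, $I_j=[z_{j-1},z_j)$ for $j=1,\dots,N$, and $I_{N+1}=[z_N,\infty)$. The relative permittivity $\varepsilon(z)>0$ and conductivity $\sigma(z)\ge 0$ are real functions on $[0,\infty)$ with $\varepsilon=\varepsilon_j$, $\sigma=\sigma_j$ on $I_j$, where $\varepsilon_j,\sigma_j$ are smooth on $I_j$ and, for $j\le N$, have finite limits as $z\to z_j-0$ (so only finite jumps occur at the $z_j$). On $I_{N+1}$, $\varepsilon=\varepsilon_{N+1}$ is a positive constant and $\sigma=0$. Wave number: for $\omega=\omega_1+i\omega_2$ with $\omega_1>0$, $\omega_2\le0$, $$k_z^2(z)=\mu\varepsilon(z)c^{-2}\omega^2-i\mu_0\mu\sigma(z)\omega ,$$ and $k_z(z)$ is the negative square root if it is real, and the square root with positive imaginary part otherwise. Write $k_j(z)=k_z(z)$ for $z\in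 I_j$; in particular $k_{N+1}=-\frac{\omega}{c}\sqrt{\mu\varepsilon_{N+1}}$. Put $k^0=-\omega/c$. Field: for a given nonzero complex number $h$ (the source amplitude at the frequency $\omega$) and a real source position $z_s<0$, $\tilde E:[0,L]\to\mathbb C$ is the $C^1$ solution of $$\tilde E''+k_z^2(z)\tilde E=0 \ \text{ (on each } I_j,\ j\le N),\qquad (\tilde E'+ik^0\tilde E)\big|_{z=0}=h\,e^{-ik^0z_s},\qquad (\tilde E'-ik_z(L)\tilde E)\big|_{z=L}=0 .$$ It is known that if $\omega_1>0$ and $\omega_2<0$ then $\tilde E(z)\ne0$ and $\operatorname{Im}(\tilde E'(z)/\tilde E(z))\le 0$ for all $z\in[0,L]$. Hence one may define $q(z)=\tilde E'(z)/\tilde E(z)$ on $[0,L]$. Then $q$ is continuous and satisfies $q'+q^2+k_j^2=0$ on $I_j$ for $j=1,\dots,N$, and $q(L)=ik_z(L)$; it is extended by $q(z)=ik_{N+1}$ for $z\in I_{N+1}$. For $j=1,\dots,N+1$ and $z\in I_j$ define $$u_j(z)=\frac{-i\,q(z)}{k_j(z)},\qquad w_j(z)=\frac{u_j(z)-1}{u_j(z)+1}.$$ *)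

(* Defs.v *)
From Stdlib Require Export Reals.
From Coquelicot Require Export Coquelicot.

Open Scope R_scope.

(* [is_derive] with the difference quotient restricted to D; on a half-open
   interval [a, b) this is the one-sided derivative at a. *)
Definition is_derive_within {V : NormedModule R_AbsRing}
    (D : R -> Prop) (f : R -> V) (x : R) (l : V) : Prop :=
  filterdiff f (within D (locally x)) (fun y : R => scal y l).

(* d n is the n-th derivative of f on D. *)
Definition smooth_on (D : R -> Prop) (f : R -> R) : Prop :=
  exists d : nat -> R -> R,
    (forall x, D x -> d 0%nat x = f x) /\
    (forall n x, D x -> is_derive_within D (d n) x (d (S n) x)).

Definition Cexp (s : C) : C := (exp (Re s) * cos (Im s), exp (Re s) * sin (Im s)).

(* For 1 <= j <= N the interval I_j = [z_{j-1}, z_j), and I_{N+1} = [z_N, oo). *)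
Definition layer (N : nat) (z : nat -> R) (j : nat) (x : R) : Prop :=
  z (pred j) <= x /\ ((j <= N)%nat -> x < z j).

Record layered_medium (N : nat) (z : nat -> R) (L : R) (eps sigma : R -> R) : Prop := {
  lm_N : (1 <= N)%nat;
  lm_z0 : z 0%nat = 0;
  lm_incr : forall j, (j < N)%nat -> z j < z (S j);
  lm_zN : z N = L;
  lm_eps_pos : forall x, 0 <= x -> 0 < eps x;
  lm_sigma_nneg : forall x, 0 <= x -> 0 <= sigma x;
  lm_eps_smooth : forall j, (1 <= j <= N)%nat -> smooth_on (layer N z j) eps;
  lm_sigma_smooth : forall j, (1 <= j <= N)%nat -> smooth_on (layer N z j) sigma;
  lm_eps_lim : forall j, (1 <= j <= N)%nat ->
    exists l : R, filterlim eps (at_left (z j)) (locally l);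
  lm_sigma_lim : forall j, (1 <= j <= N)%nat ->
    exists l : R, filterlim sigma (at_left (z j)) (locally l);
  lm_last : exists eps_last : R, forall x, layer N z (S N) x ->
    eps x = eps_last /\ sigma x = 0
}.

Definition kz_sq (c mu0 mu : R) (eps sigma : R -> R) (omega : C) (x : R) : C :=
  (RtoC (mu * eps x / c ^ 2) * (omega * omega)
   - Ci * RtoC (mu0 * mu * sigma x) * omega)%C.

(* k is the negative square root of s if s has one, and the square root of s
   with positive imaginary part otherwise. *)
Definition is_wave_root (s k : C) : Prop :=
  (k * k)%C = s /\ ((Im k = 0 /\ Re k < 0) \/ 0 < Im k).

Definition k0 (c : R) (omega : C) : C := (- (omega / RtoC c))%C.

(* E is the field and dE its derivative on [0, L]. *)
Record field_solution (c mu0 mu : R) (N : nat) (z : nat -> R) (L : R)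
    (eps sigma : R -> R) (omega : C) (k : R -> C) (h : C) (zs : R)
    (E dE : R -> C) : Prop := {
  fs_derive : forall x, 0 <= x <= L ->
    is_derive_within (V := C_R_NormedModule) (fun y => 0 <= y <= L) E x (dE x);
  fs_C1 : continuous_on (fun y => 0 <= y <= L) dE;
  fs_ode : forall j x, (1 <= j <= N)%nat -> layer N z j x ->
    exists ddE : C,
      is_derive_within (V := C_R_NormedModule) (layer N z j) dE x ddE /\
      (ddE + kz_sq c mu0 mu eps sigma omega x * E x = 0)%C;
  fs_source : (dE 0 + Ci * k0 c omega * E 0
               = h * Cexp (- (Ci * k0 c omega * RtoC zs)))%C;
  fs_radiation : (dE L - Ci * k L * E L = 0)%C
}.

Definition q (L : R) (k E dE : R -> C) (x : R) : C :=
  if Rle_dec x L then (dE x / E x)%C else (Ci * k x)%C.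

(* u and w are the functions equal to u_j and w_j on I_j; the intervals
   I_1, ..., I_{N+1} partition [0, oo). *)
Definition u (L : R) (k E dE : R -> C) (x : R) : C :=
  (- Ci * q L k E dE x / k x)%C.

Definition w (L : R) (k E dE : R -> C) (x : R) : C :=
  ((u L k E dE x - 1) / (u L k E dE x + 1))%C.

Definition phi (K : R) : R := sqrt (2 + K ^ 2) - K.

Definition condition_A (c mu0 L : R) (eps sigma : R -> R) (omega1 omega2 : R) : Prop :=
  exists K : R, 0 < K /\
    (forall x, 0 <= x <= L -> sigma x / eps x <= 2 * K * omega1 / (mu0 * c ^ 2)) /\
    - (1 + phi K) * omega1 <= omega2 <= (1 - sqrt 2) * omega1.

Definition c0 : R := tan (3 * PI / 8) + / cos (3 * PI / 8).

Definition condition_B (c mu : R) (N : nat) (z : nat -> R) (eps sigma : R -> R)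
    (omega1 omega2 delta : R) (K lambda : nat -> R) : Prop :=
  0 < delta <= sqrt 2 - 1 /\
  forall j, (1 <= j <= N)%nat ->
    (forall x, layer N z j x ->
      (forall d, is_derive_within (layer N z j) eps x d ->
        Rabs d <= 4 * lambda j
          * (Rabs (omega1 * omega2) / Cmod (omega1, omega2) ^ 2) * eps x) /\
      (forall d, is_derive_within (layer N z j) sigma x d ->
        Rabs d <= 2 * lambda j * (omega1 / Cmod (omega1, omega2)) * sigma x) /\
      4 * / c * sqrt (mu * eps x * omega1 * Rabs omega2 / (sqrt 2 + 1))
        - c0 * lambda j >= K j) /\
    K j > 0 /\
    exp (- K j * (z j - z (pred j))) + lambda j / K j * (1 + lambda j / K j)
      <= delta ^ 2.

(* Main.v *)
Require Import Defs.
From Stdlib Require Import Lra Lia Psatz.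

(* For omega2 < 0 the flux Im (conj E * E') is nondecreasing and negative at L,
   so E never vanishes and Im q <= 0 on [0, L].  Condition A places k_z^2 in the
   sector |Re| <= - Im, hence arg k_j lies in [5 pi/8, 7 pi/8]; as -i q lies in the
   left half plane, |arg u_j| <= 7 pi/8, which gives |w_j| <= c0.  On a layer
   w' = -2 i k w - (k' / (2 k)) (1 - w^2), and condition B gives
   |k' / (2 k)| <= lambda / 2 and 4 Im k >= C_j + c0 lambda, so that y = |w|^2
   satisfies y' >= C_j y - lambda sqrt y, and Gronwall backward from z_j gives the
   bounds on I_j.  At an interface |w_{j+1}| <= delta <= tan (pi/8) yields
   |arg u_{j+1}| <= pi/4, while k_j and k_{j+1} differ in argument by at most pi/4,
   so |arg u_j| <= pi/2 and |w_j(z_j - 0)| <= 1; one descends on j from w(L) = 0. *)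

(** * Limits and differential inequalities *)

(** The bound |w| <= c0 breaks a circularity. The equation for w only gives y' >= 4 Im k y - lambda
    sqrt y (1 + y), and the term sqrt y y cannot be treated as linear before y is bounded. Since c0
    depends on sectors alone, that term is at most c0 y, which is why condition B subtracts c0
    lambda from the rate. Both angular constants come from u = (1 + w) / (1 - w). If |arg u| <=
    theta with pi/2 <= theta < pi, then |w| <= tan (theta/2), hence c0 = tan (7 pi/16). If |w| <= t
    < 1, then |arg u| <= 2 arctan t, hence the threshold tan (pi/8) = sqrt 2 - 1 for delta. Apart
    from c0, angles are encoded as inequalities between real and imaginary parts, and |w|^2 as the
    quotient of |E' - i k E|^2 by |E' + i k E|^2. The sign of the flux makes this denominator
    positive. The sign of the flux at L requires E(L) <> 0: otherwise the radiation condition makes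
    all data vanish at L, backward uniqueness carries zero data to z = 0, and the source term would
    vanish. *)

Lemma is_derive_within_interior {V : NormedModule R_AbsRing}
  (D : R -> Prop) (f : R -> V) (x : R) (l : V) :
  locally x D -> is_derive_within D f x l -> is_derive f x l.
Proof.
intros HD [Hl Hd]; split; [exact Hl|].
intros y Hy e.
assert (Hw : is_filter_lim (within D (locally x)) y).
{ intros P HP; apply (filter_le_within D); exact (Hy P HP). }
generalize (filter_and _ _ HD (Hd y Hw e)).
apply filter_imp; intros t [H1 H2]; exact (H2 H1).
Qed.

Lemma is_derive_within_filterlim {V : NormedModule R_AbsRing}
  (D : R -> Prop) (f : R -> V) (x : R) (l : V) :
  is_derive_within D f x l -> filterlim f (within D (locally x)) (locally (f x)).
Proof.
intros H; apply (filterdiff_continuous_aux (F := within D (locally x))).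
- now exists (fun y => scal y l).
- intros P HP; apply (filter_le_within D); exact HP.
Qed.

Lemma filterlim_within {T U : Type} (F : (T -> Prop) -> Prop) {FF : Filter F}
  (D : T -> Prop) (f : T -> U) (G : (U -> Prop) -> Prop) :
  filterlim f F G -> filterlim f (within D F) G.
Proof. intros H P HP; apply (filter_le_within D); exact (H P HP). Qed.

Lemma is_derive_C_components (f : R -> C) (x : R) (l : C) :
  is_derive (V := C_R_NormedModule) f x l ->
  is_derive (fun t => Re (f t)) x (Re l) /\ is_derive (fun t => Im (f t)) x (Im l).
Proof.
intros H; split.
- apply (filterdiff_comp (F := locally x) (V := C_R_NormedModule) f fst
    (fun y => scal y l) fst H).
  apply filterdiff_linear, is_linear_fst.
- apply (filterdiff_comp (F := locally x) (V := C_R_NormedModule) f snd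
    (fun y => scal y l) snd H).
  apply filterdiff_linear, is_linear_snd.
Qed.

Lemma filterlim_C_components {T : Type} (F : (T -> Prop) -> Prop) {FF : Filter F}
  (f : T -> C) (l : C) :
  filterlim f F (locally l) ->
  filterlim (fun t => Re (f t)) F (locally (Re l)) /\
  filterlim (fun t => Im (f t)) F (locally (Im l)).
Proof.
intros H; split;
  (eapply filterlim_comp; [exact H|]); [apply continuous_fst|apply continuous_snd].
Qed.

Lemma filterlim_Rplus {T : Type} (F : (T -> Prop) -> Prop) {FF : Filter F}
  (f g : T -> R) (a b : R) :
  filterlim f F (locally a) -> filterlim g F (locally b) ->
  filterlim (fun t => f t + g t) F (locally (a + b)).
Proof. intros Hf Hg; exact (filterlim_comp_2 _ _ _ Hf Hg (filterlim_plus a b)). Qed.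

Lemma filterlim_Rmult {T : Type} (F : (T -> Prop) -> Prop) {FF : Filter F}
  (f g : T -> R) (a b : R) :
  filterlim f F (locally a) -> filterlim g F (locally b) ->
  filterlim (fun t => f t * g t) F (locally (a * b)).
Proof. intros Hf Hg; exact (filterlim_comp_2 _ _ _ Hf Hg (filterlim_mult a b)). Qed.

Lemma filterlim_continuous {T : Type} (F : (T -> Prop) -> Prop) {FF : Filter F}
  (phi : R -> R) (f : T -> R) (a : R) :
  continuous phi a -> filterlim f F (locally a) ->
  filterlim (fun t => phi (f t)) F (locally (phi a)).
Proof. intros Hp Hf; exact (filterlim_comp _ _ _ f phi _ _ _ Hf Hp). Qed.

Lemma filterlim_Ropp {T : Type} (F : (T -> Prop) -> Prop) {FF : Filter F}
  (f : T -> R) (a : R) :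
  filterlim f F (locally a) -> filterlim (fun t => - f t) F (locally (- a)).
Proof.
apply (filterlim_continuous F Ropp), (continuous_opp (fun t : R => t)), continuous_id.
Qed.

Lemma filterlim_Rminus {T : Type} (F : (T -> Prop) -> Prop) {FF : Filter F}
  (f g : T -> R) (a b : R) :
  filterlim f F (locally a) -> filterlim g F (locally b) ->
  filterlim (fun t => f t - g t) F (locally (a - b)).
Proof. intros Hf Hg; now apply filterlim_Rplus, filterlim_Ropp. Qed.

Lemma filterlim_Rdiv {T : Type} (F : (T -> Prop) -> Prop) {FF : Filter F}
  (f g : T -> R) (a b : R) : b <> 0 ->
  filterlim f F (locally a) -> filterlim g F (locally b) ->
  filterlim (fun t => f t / g t) F (locally (a / b)).
Proof.
intros Hb Hf Hg; refine (filterlim_Rmult _ _ _ _ _ Hf _).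
now apply (filterlim_continuous F Rinv); [apply continuous_Rinv|].
Qed.

Lemma filterlim_sqrt {T : Type} (F : (T -> Prop) -> Prop) {FF : Filter F}
  (f : T -> R) (a : R) :
  filterlim f F (locally a) -> filterlim (fun t => sqrt (f t)) F (locally (sqrt a)).
Proof. apply (filterlim_continuous F sqrt), continuous_sqrt. Qed.

Lemma filterlim_pow {T : Type} (F : (T -> Prop) -> Prop) {FF : Filter F}
  (f : T -> R) (a : R) (n : nat) :
  filterlim f F (locally a) -> filterlim (fun t => f t ^ n) F (locally (a ^ n)).
Proof.
intros Hf; apply (filterlim_continuous F (fun t => t ^ n)); [|exact Hf].
apply (ex_derive_continuous (fun t => t ^ n)); auto_derive; trivial.
Qed.

Ltac real_filterlim :=
  repeat first
    [ assumption
    | refine (filterlim_Rplus _ _ _ _ _ _ _) | refine (filterlim_Rminus _ _ _ _ _ _ _)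
    | refine (filterlim_Ropp _ _ _ _) | refine (filterlim_Rmult _ _ _ _ _ _ _)
    | refine (filterlim_Rdiv _ _ _ _ _ _ _ _) | refine (filterlim_sqrt _ _ _ _)
    | refine (filterlim_pow _ _ _ _ _) | refine (filterlim_const _) ].

Lemma filterlim_ge_const {T : Type} (F : (T -> Prop) -> Prop) {FF : ProperFilter F}
  (f : T -> R) (c l : R) :
  filterlim f F (locally l) -> F (fun t => c <= f t) -> c <= l.
Proof.
intros Hf Hc.
exact (filterlim_le (F := F) (fun _ => c) f (Finite c) (Finite l) Hc
  (filterlim_const _) Hf).
Qed.

Lemma filterlim_le_const {T : Type} (F : (T -> Prop) -> Prop) {FF : ProperFilter F}
  (f : T -> R) (c l : R) :
  filterlim f F (locally l) -> F (fun t => f t <= c) -> l <= c.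
Proof.
intros Hf Hc.
exact (filterlim_le (F := F) f (fun _ => c) (Finite l) (Finite c) Hc
  Hf (filterlim_const _)).
Qed.

Lemma at_left_interval (a b : R) : a < b -> at_left b (fun t => a < t < b).
Proof.
intros Hab; assert (Hp : 0 < b - a) by lra.
exists (mkposreal _ Hp); intros t Ht Htb.
change (Rabs (t - b) < b - a) in Ht; apply Rabs_def2 in Ht; lra.
Qed.

Lemma at_right_interval (a b : R) : a < b -> at_right a (fun t => a < t < b).
Proof.
intros Hab; assert (Hp : 0 < b - a) by lra.
exists (mkposreal _ Hp); intros t Ht Hta.
change (Rabs (t - a) < b - a) in Ht; apply Rabs_def2 in Ht; lra.
Qed.

Lemma locally_open_interval (a b x : R) : a < x < b -> locally x (fun t => a < t < b).
Proof.
intros Hx; apply (filter_and (fun t => a < t) (fun t => t < b));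
  [apply (open_gt a)|apply (open_lt b)]; tauto.
Qed.

(** The comparison is with the left limit [l], not with [g b], because the coefficients may jump at
    [b]. The mean value theorem works inside; the endpoint [a] is reached through the right
    limit. *)
Lemma nondecreasing_left_limit (g : R -> R) (a b l : R) : a < b ->
  (forall x, a < x < b -> exists d, is_derive g x d /\ 0 <= d) ->
  filterlim g (at_right a) (locally (g a)) ->
  filterlim g (at_left b) (locally l) ->
  forall x, a <= x < b -> g x <= l.
Proof.
intros Hab Hd Ha Hb.
assert (Hinc : forall s t, a < s -> s <= t -> t < b -> g s <= g t).
{ intros s t Hs Hst Ht.
  destruct (MVT_gen g s t (Derive g)) as [c [Hc Heq]].
  - rewrite Rmin_left, Rmax_right by lra; intros x Hx.
    destruct (Hd x) as [d [H1 _]]; [lra|].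
    apply Derive_correct; now exists d.
  - rewrite Rmin_left, Rmax_right by lra; intros x Hx.
    destruct (Hd x) as [d [H1 _]]; [lra|].
    apply continuity_pt_filterlim, (ex_derive_continuous g); now exists d.
  - rewrite Rmin_left, Rmax_right in Hc by lra.
    destruct (Hd c) as [d [H1 H2]]; [lra|].
    rewrite (is_derive_unique _ _ _ H1) in Heq; nra. }
assert (Hint : forall x, a < x < b -> g x <= l).
{ intros x Hx; apply (filterlim_ge_const _ _ _ _ Hb).
  generalize (at_left_interval x b (proj2 Hx)); apply filter_imp.
  intros t Ht; apply Hinc; lra. }
intros x [[Hx|<-] Hxb]; [now apply Hint|].
apply (filterlim_le_const _ _ _ _ Ha).
generalize (at_right_interval a b Hab); apply filter_imp; exact Hint.
Qed.

(** From f' >= A (f - v), the function (f - v) exp (- A x) is nondecreasing. Both signs of [A] occur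
    below: A > 0 gives decay away from [b], A < 0 limits the growth backward from [b]. *)
Lemma gronwall_backward (f : R -> R) (a b l A v : R) : a < b ->
  (forall x, a < x < b -> exists d, is_derive f x d /\ A * (f x - v) <= d) ->
  filterlim f (at_right a) (locally (f a)) ->
  filterlim f (at_left b) (locally l) ->
  forall x, a <= x < b -> f x <= v + exp (- A * (b - x)) * (l - v).
Proof.
intros Hab Hd Ha Hb x Hx.
assert (Hexp : forall t : R, continuous (fun t => exp (- A * t)) t).
{ intros t; apply (ex_derive_continuous (fun t => exp (- A * t))); auto_derive; trivial. }
assert (H : (f x - v) * exp (- A * x) <= (l - v) * exp (- A * b)).
{ apply (nondecreasing_left_limit (fun t => (f t - v) * exp (- A * t)) a b);
    [exact Hab| | | |exact Hx].
  - intros t Ht; destruct (Hd t Ht) as [d [H1 H2]].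
    exists ((d - A * (f t - v)) * exp (- A * t)); split.
    + auto_derive; [now exists d|].
      rewrite (is_derive_unique (fun s : R => f s) _ _ H1); ring.
    + apply Rmult_le_pos; [lra|apply Rlt_le, exp_pos].
  - refine (filterlim_Rmult _ _ _ _ _ _ _); [real_filterlim|].
    exact (filterlim_within _ _ _ _ (Hexp a)).
  - refine (filterlim_Rmult _ _ _ _ _ _ _); [real_filterlim|].
    exact (filterlim_within _ _ _ _ (Hexp b)). }
replace (exp (- A * (b - x))) with (exp (- A * b) * / exp (- A * x)).
2: { rewrite <- exp_Ropp, <- exp_plus; f_equal; ring. }
pose proof (exp_pos (- A * x)) as Hp.
apply (Rmult_le_compat_r (/ exp (- A * x))) in H; [|now apply Rlt_le, Rinv_0_lt_compat].
rewrite Rmult_assoc, Rinv_r, Rmult_1_r in H by lra; lra.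
Qed.

(** Two applications of Gronwall, with r = lam / A. The first spends half of the rate on the square
    root and bounds y by (1 + r)^2 on the whole interval. The second inserts sqrt y <= 1 + r and so
    keeps the full rate [A] in the exponential at [a]. *)
Lemma layer_decay (y : R -> R) (a b l A lam : R) : a < b -> 0 < A -> 0 <= lam ->
  (forall x, a < x < b -> 0 <= y x /\
     exists d, is_derive y x d /\ A * y x - lam * sqrt (y x) <= d) ->
  filterlim y (at_right a) (locally (y a)) ->
  filterlim y (at_left b) (locally l) -> l <= 1 ->
  (forall x, a <= x < b -> y x <= (1 + lam / A) ^ 2) /\
  y a <= exp (- A * (b - a)) + lam / A * (1 + lam / A).
Proof.
intros Hab HA Hlam Hy Ha Hb Hl.
assert (Hr : 0 <= lam / A) by (apply Rdiv_le_0_compat; lra).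
set (r := lam / A) in *.
assert (Hlr : lam = A * r) by (unfold r; field; lra).
assert (Hbd : forall x, a <= x < b -> y x <= (1 + r) ^ 2).
{ intros x Hx.
  assert (H := gronwall_backward y a b l (A / 2) (r ^ 2) Hab).
  assert (Hg : y x <= r ^ 2 + exp (- (A / 2) * (b - x)) * (l - r ^ 2)).
  { apply H; [|exact Ha|exact Hb|exact Hx].
    intros t Ht; destruct (Hy t Ht) as [H0 [d [H1 H2]]].
    exists d; split; [exact H1|].
    pose proof (sqrt_sqrt _ H0) as Hs.
    pose proof (sqrt_pos (y t)) as Hsp.
    (* AM-GM: lam sqrt y <= (A / 2) (y + (lam / A) ^ 2) *)
    assert (0 <= A / 2 * (sqrt (y t) - r) ^ 2)
      by (apply Rmult_le_pos; [lra|apply pow2_ge_0]).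
    rewrite Hlr in H2; nra. }
  assert (He : exp (- (A / 2) * (b - x)) <= 1).
  { rewrite <- exp_0; apply Rlt_le, exp_increasing; nra. }
  pose proof (exp_pos (- (A / 2) * (b - x))) as Hep.
  set (e := exp _) in *; nra. }
split; [exact Hbd|].
(* Here lam sqrt y <= A r (1 + r), so the constant [v] of Gronwall is r (1 + r). *)
assert (Hg : y a <= r * (1 + r) + exp (- A * (b - a)) * (l - r * (1 + r))).
{ apply (gronwall_backward y a b); [exact Hab| |exact Ha|exact Hb|lra].
  intros t Ht; destruct (Hy t Ht) as [H0 [d [H1 H2]]].
  exists d; split; [exact H1|].
  assert (Hs : sqrt (y t) <= 1 + r).
  { rewrite <- (sqrt_pow2 (1 + r)) by lra; apply sqrt_le_1_alt, Hbd; lra. }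
  rewrite Hlr in H2; assert (0 <= A * r) by nra; nra. }
pose proof (exp_pos (- A * (b - a))) as Hep.
set (e := exp _) in *; assert (0 <= r * (1 + r)) by nra; nra.
Qed.

(** * The square root with nonpositive real part *)

(** The half-angle formulas for a square root of s1 + i s2 with s2 <= 0, on the branch Re <= 0 <=
    Im. Being explicit and continuous, they also make sense at the limit of k^2 at an interface. *)
Definition root_re (s1 s2 : R) : R := - sqrt ((sqrt (s1 ^ 2 + s2 ^ 2) + s1) / 2).
Definition root_im (s1 s2 : R) : R := sqrt ((sqrt (s1 ^ 2 + s2 ^ 2) - s1) / 2).

Lemma Rabs_le_hypot (x y : R) : Rabs x <= sqrt (x ^ 2 + y ^ 2).
Proof. rewrite <- (sqrt_pow2 (Rabs x)) by apply Rabs_pos; apply sqrt_le_1_alt.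
rewrite pow2_abs; nra. Qed.

Lemma root_spec (s1 s2 : R) : s2 <= 0 ->
  root_re s1 s2 <= 0 /\ 0 <= root_im s1 s2 /\
  root_re s1 s2 ^ 2 - root_im s1 s2 ^ 2 = s1 /\
  2 * root_re s1 s2 * root_im s1 s2 = s2.
Proof.
intros H; unfold root_re, root_im.
pose proof (Rabs_le_hypot s1 s2) as Hm.
pose proof (Rle_abs s1) as H1; pose proof (Rle_abs (- s1)) as H2.
rewrite Rabs_Ropp in H2.
assert (Hr : sqrt (s1 ^ 2 + s2 ^ 2) ^ 2 = s1 ^ 2 + s2 ^ 2) by (apply pow2_sqrt; nra).
set (r := sqrt (s1 ^ 2 + s2 ^ 2)) in *.
pose proof (sqrt_pos ((r + s1) / 2)); pose proof (sqrt_pos ((r - s1) / 2)).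
repeat split; [lra|lra| |].
- replace ((- sqrt ((r + s1) / 2)) ^ 2) with (sqrt ((r + s1) / 2) ^ 2) by ring.
  rewrite !pow2_sqrt by lra; lra.
- replace (2 * _ * _) with (- (2 * (sqrt ((r + s1) / 2) * sqrt ((r - s1) / 2)))) by ring.
  rewrite <- sqrt_mult by lra.
  replace ((r + s1) / 2 * ((r - s1) / 2)) with ((- s2 / 2) ^ 2) by nra.
  rewrite sqrt_pow2 by lra; lra.
Qed.

Lemma root_strict (s1 s2 : R) : s2 < 0 -> root_re s1 s2 < 0 < root_im s1 s2.
Proof.
intros H; destruct (root_spec s1 s2) as [H1 [H2 [_ H3]]]; [lra|]; nra.
Qed.

Lemma is_wave_root_unique (s k : C) : Im s < 0 -> is_wave_root s k ->
  Re k = root_re (Re s) (Im s) /\ Im k = root_im (Re s) (Im s).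
Proof.
intros Hs [Hk Hp].
destruct (root_spec (Re s) (Im s)) as [_ [_ [H1 H2]]]; [lra|].
destruct (root_strict (Re s) (Im s) Hs) as [Ha Hb].
set (a := root_re _ _) in *; set (b := root_im _ _) in *.
rewrite <- Hk in H1, H2, Hs; destruct k as [x y]; simpl in *.
(* A real k would make Im s vanish, so k lies in the upper half plane; then 2 x y = Im s < 0 forces
   x < 0. *)
assert (Hy : 0 < y) by (destruct Hp as [[Hy _]|Hy]; [rewrite Hy in Hs; lra|exact Hy]).
assert (Hx : x < 0) by nra.
(* (x - a) (x + a) = (y - b) (y + b) and x y = a b, where x + a < 0 < y + b *)
assert (Hxa : (x - a) * ((x + a) ^ 2 + (y + b) ^ 2) = 0) by nra.
assert (Hyb : (y - b) * ((x + a) ^ 2 + (y + b) ^ 2) = 0) by nra.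
assert (Hpos : (x + a) ^ 2 + (y + b) ^ 2 <> 0) by nra.
apply Rmult_integral in Hxa; apply Rmult_integral in Hyb; split; lra.
Qed.

(** The last two equations are 2 k k' = s' in real and imaginary parts; later estimates use [a'] and
    [b'] only through them. The condition s2 < 0 gives |s1| < |s|, so that both radicands are
    positive and the square roots differentiable. *)
Lemma root_derive (s1 s2 : R -> R) (x d1 d2 : R) :
  is_derive s1 x d1 -> is_derive s2 x d2 -> s2 x < 0 ->
  exists a' b', is_derive (fun t => root_re (s1 t) (s2 t)) x a' /\
    is_derive (fun t => root_im (s1 t) (s2 t)) x b' /\
    2 * (root_re (s1 x) (s2 x) * a' - root_im (s1 x) (s2 x) * b') = d1 /\
    2 * (root_re (s1 x) (s2 x) * b' + root_im (s1 x) (s2 x) * a') = d2.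
Proof.
intros H1 H2 Hneg.
assert (Hr : is_derive (fun t => sqrt (s1 t ^ 2 + s2 t ^ 2)) x
  ((2 * s1 x * d1 + 2 * s2 x * d2) / (2 * sqrt (s1 x ^ 2 + s2 x ^ 2)))).
{ apply (is_derive_sqrt (fun t => s1 t ^ 2 + s2 t ^ 2)).
  - auto_derive; [split; [now exists d1|split; [now exists d2|trivial]]|].
    rewrite (is_derive_unique (fun s : R => s1 s) _ _ H1),
      (is_derive_unique (fun s : R => s2 s) _ _ H2); ring.
  - nra. }
assert (Hgt : Rabs (s1 x) < sqrt (s1 x ^ 2 + s2 x ^ 2)).
{ rewrite <- (sqrt_pow2 (Rabs (s1 x))) by apply Rabs_pos; apply sqrt_lt_1_alt.
  rewrite pow2_abs; nra. }
apply Rabs_def2 in Hgt.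
assert (Hr2 : sqrt (s1 x ^ 2 + s2 x ^ 2) ^ 2 = s1 x ^ 2 + s2 x ^ 2)
  by (apply pow2_sqrt; nra).
set (dr := _ / _) in Hr.
assert (Hdr : sqrt (s1 x ^ 2 + s2 x ^ 2) * dr = s1 x * d1 + s2 x * d2)
  by (unfold dr; field; lra).
clearbody dr.
assert (Hhalf : forall (g : R -> R) (d : R),
  is_derive g x d -> is_derive (fun t => g t / 2) x (d / 2)).
{ intros g d Hg; auto_derive; [now exists d|].
  rewrite (is_derive_unique (fun s : R => g s) _ _ Hg); field. }
assert (Ha : is_derive (fun t => root_re (s1 t) (s2 t)) x
  (- ((dr + d1) / 2 / (2 * sqrt ((sqrt (s1 x ^ 2 + s2 x ^ 2) + s1 x) / 2))))).
{ unfold root_re; apply (is_derive_opp (fun t => sqrt _)).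
  apply (is_derive_sqrt (fun t => (sqrt (s1 t ^ 2 + s2 t ^ 2) + s1 t) / 2)); [|lra].
  apply (Hhalf (fun t => sqrt (s1 t ^ 2 + s2 t ^ 2) + s1 t)).
  now apply (is_derive_plus (fun t => sqrt (s1 t ^ 2 + s2 t ^ 2)) s1). }
assert (Hb : is_derive (fun t => root_im (s1 t) (s2 t)) x
  ((dr - d1) / 2 / (2 * sqrt ((sqrt (s1 x ^ 2 + s2 x ^ 2) - s1 x) / 2)))).
{ unfold root_im.
  apply (is_derive_sqrt (fun t => (sqrt (s1 t ^ 2 + s2 t ^ 2) - s1 t) / 2)); [|lra].
  apply (Hhalf (fun t => sqrt (s1 t ^ 2 + s2 t ^ 2) - s1 t)).
  now apply (is_derive_minus (fun t => sqrt (s1 t ^ 2 + s2 t ^ 2)) s1). }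
eexists; eexists; split; [exact Ha|]; split; [exact Hb|].
destruct (root_spec (s1 x) (s2 x)) as [_ [_ [_ E2]]]; [lra|].
unfold root_re, root_im in *.
set (r := sqrt (s1 x ^ 2 + s2 x ^ 2)) in *.
assert (Pa : 0 < sqrt ((r + s1 x) / 2)) by (apply sqrt_lt_R0; lra).
assert (Pb : 0 < sqrt ((r - s1 x) / 2)) by (apply sqrt_lt_R0; lra).
assert (Sa : sqrt ((r + s1 x) / 2) ^ 2 = (r + s1 x) / 2) by (apply pow2_sqrt; lra).
assert (Sb : sqrt ((r - s1 x) / 2) ^ 2 = (r - s1 x) / 2) by (apply pow2_sqrt; lra).
set (p := sqrt ((r + s1 x) / 2)) in *; set (m := sqrt ((r - s1 x) / 2)) in *.
split; [field; lra|].
(* As k = - p + i m, the factor 2 p m equals - s2, and the second equation becomes s1 d1 - r dr = -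
   s2 d2, which is [Hdr]. *)
apply (Rmult_eq_reg_l (2 * p * m)); [|nra].
transitivity (p ^ 2 * (d1 - dr) - m ^ 2 * (dr + d1)); [field; lra|].
rewrite Sa, Sb.
transitivity (s1 x * d1 - r * dr); [field|].
rewrite Hdr; replace (2 * p * m) with (- s2 x) by nra; ring.
Qed.

(** * The reflection ratio *)

(* With k = a + i b: |E' - i k E|^2 and |E' + i k E|^2, whose quotient is |w|^2. *)
Definition refl (a b e1 e2 f1 f2 : R) : R :=
  (f1 + b * e1 + a * e2) ^ 2 + (f2 - a * e1 + b * e2) ^ 2.
Definition inc (a b e1 e2 f1 f2 : R) : R :=
  (f1 - b * e1 - a * e2) ^ 2 + (f2 + a * e1 - b * e2) ^ 2.

Lemma refl_pos (a b e1 e2 f1 f2 : R) : 0 <= refl a b e1 e2 f1 f2.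
Proof. apply Rplus_le_le_0_compat; apply pow2_ge_0. Qed.

(* The flux e1 f2 - e2 f1 is Im (conj E * E'). *)
Lemma inc_pos (a b e1 e2 f1 f2 : R) : a <= 0 -> e1 * f2 - e2 * f1 < 0 ->
  0 < inc a b e1 e2 f1 f2.
Proof.
intros Ha HF; unfold inc.
destruct (Req_dec (f1 - b * e1 - a * e2) 0) as [H1|H1];
  [|now apply Rplus_lt_le_0_compat; [apply pow2_gt_0|apply pow2_ge_0]].
destruct (Req_dec (f2 + a * e1 - b * e2) 0) as [H2|H2];
  [|now apply Rplus_le_lt_0_compat; [apply pow2_ge_0|apply pow2_gt_0]].
(* If both squares vanish then E' = - i k E, whose flux is - a |E|^2 >= 0. *)
replace f1 with (b * e1 + a * e2) in HF by lra.
replace f2 with (b * e2 - a * e1) in HF by lra.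
assert (0 <= - a * (e1 ^ 2 + e2 ^ 2)) by (apply Rmult_le_pos; nra); nra.
Qed.

Lemma Re_le_Cmod (x : C) : Re x <= Cmod x.
Proof. eapply Rle_trans; [apply Rle_abs|apply Rabs_le_hypot]. Qed.

Lemma Cmod_eq_sqrt (x : C) : Cmod x = sqrt (Re x ^ 2 + Im x ^ 2).
Proof. reflexivity. Qed.

(** With w = P / Q and M = k' / (2 k), the left side is 2 Re (M conj w (1 - w^2)), the contribution
    of the variation of k to the derivative of |w|^2. *)
Lemma ratio_derivative_bound (M P Q : C) (lam : R) :
  2 * Cmod M <= lam -> Q <> 0 ->
  2 * Re (M * (Cconj P * Cconj Q * (Q * Q - P * P))) / (Cmod Q ^ 2) ^ 2 <=
  lam * sqrt (Cmod P ^ 2 / Cmod Q ^ 2) * (1 + Cmod P ^ 2 / Cmod Q ^ 2).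
Proof.
intros HM HQ.
assert (Hq : 0 < Cmod Q) by now apply Cmod_gt_0.
assert (Hp := Cmod_ge_0 P); assert (Hm := Cmod_ge_0 M).
assert (HR : Re (M * (Cconj P * Cconj Q * (Q * Q - P * P))) <=
  Cmod M * (Cmod P * Cmod Q * (Cmod Q ^ 2 + Cmod P ^ 2))).
{ eapply Rle_trans; [apply Re_le_Cmod|].
  rewrite !Cmod_mult, !Cmod_conj.
  repeat (apply Rmult_le_compat_l; [now repeat apply Rmult_le_pos; try apply Cmod_ge_0|]).
  unfold Cminus; eapply Rle_trans; [apply Cmod_triangle|].
  rewrite Cmod_opp, !Cmod_mult; lra. }
replace (Cmod P ^ 2 / Cmod Q ^ 2) with ((Cmod P / Cmod Q) ^ 2) by (field; lra).
rewrite sqrt_pow2 by (apply Rdiv_le_0_compat; lra).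
assert (Hq4 : 0 < (Cmod Q ^ 2) ^ 2) by now repeat apply pow_lt.
apply (Rmult_le_reg_r ((Cmod Q ^ 2) ^ 2)); [exact Hq4|].
unfold Rdiv at 1; rewrite Rmult_assoc, Rinv_l, Rmult_1_r by lra.
set (Z := Cmod P * Cmod Q * (Cmod Q ^ 2 + Cmod P ^ 2)) in *.
assert (HZ : 0 <= Z) by (unfold Z; apply Rmult_le_pos; nra).
apply Rle_trans with (lam * Z); [nra|].
apply Req_le; unfold Z; field; lra.
Qed.

(** The witness is m1 + i m2 = k' / (2 k). The hypothesis reads |2 k k'| <= 2 lam |Im k^2|, and |Im
    k^2| = 2 |a b| <= |k|^2, so |k' / (2 k)| = |2 k k'| / (4 |k|^2) <= lam / 2. *)
Lemma log_derivative_bound (a b a' b' lam : R) : a < 0 < b ->  0 <= lam ->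
  (2 * (a * a' - b * b')) ^ 2 + (2 * (a * b' + b * a')) ^ 2
    <= (2 * lam * (2 * a * b)) ^ 2 ->
  exists m1 m2, a' = 2 * (m1 * a - m2 * b) /\ b' = 2 * (m1 * b + m2 * a) /\
    2 * Cmod (m1, m2) <= lam.
Proof.
intros [Ha Hb] Hl H.
assert (Hn : 0 < a ^ 2 + b ^ 2) by nra.
exists ((a * a' + b * b') / (2 * (a ^ 2 + b ^ 2))),
  ((a * b' - b * a') / (2 * (a ^ 2 + b ^ 2))).
split; [field; lra|]; split; [field; lra|].
rewrite Cmod_eq_sqrt; simpl Re; simpl Im.
replace (_ ^ 2 + _ ^ 2) with ((a' ^ 2 + b' ^ 2) / (4 * (a ^ 2 + b ^ 2))) by (field; lra).
assert (H' : (a' ^ 2 + b' ^ 2) * (a ^ 2 + b ^ 2) <= (lam * (a ^ 2 + b ^ 2)) ^ 2).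
{ assert (H1 : 4 * (a * b) ^ 2 <= (a ^ 2 + b ^ 2) ^ 2)
    by (pose proof (pow2_ge_0 (a ^ 2 - b ^ 2)); lra).
  apply (Rmult_le_compat_l (lam ^ 2) _ _ (pow2_ge_0 lam)) in H1; lra. }
assert (H2 : (a' ^ 2 + b' ^ 2) / (4 * (a ^ 2 + b ^ 2)) <= (lam / 2) ^ 2).
{ apply (Rmult_le_reg_r (4 * (a ^ 2 + b ^ 2))); [lra|].
  unfold Rdiv at 1; rewrite Rmult_assoc, Rinv_l, Rmult_1_r by lra; nra. }
apply sqrt_le_1_alt in H2; rewrite sqrt_pow2 in H2 by lra; lra.
Qed.

Lemma ratio_derive (a b e1 e2 f1 f2 : R -> R) (x a' b' s1 s2 lam : R) :
  is_derive e1 x (f1 x) -> is_derive e2 x (f2 x) ->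
  is_derive f1 x (- (s1 * e1 x - s2 * e2 x)) ->
  is_derive f2 x (- (s1 * e2 x + s2 * e1 x)) ->
  is_derive a x a' -> is_derive b x b' ->
  a x < 0 < b x -> a x ^ 2 - b x ^ 2 = s1 -> 2 * a x * b x = s2 ->
  0 <= lam ->
  (2 * (a x * a' - b x * b')) ^ 2 + (2 * (a x * b' + b x * a')) ^ 2
    <= (2 * lam * s2) ^ 2 ->
  0 < inc (a x) (b x) (e1 x) (e2 x) (f1 x) (f2 x) ->
  let y t := refl (a t) (b t) (e1 t) (e2 t) (f1 t) (f2 t) /
    inc (a t) (b t) (e1 t) (e2 t) (f1 t) (f2 t) in
  exists d, is_derive y x d /\
    4 * b x * y x - lam * sqrt (y x) * (1 + y x) <= d.
Proof.
intros De1 De2 Df1 Df2 Da Db Hab Hs1 Hs2 Hl Hd Hinc y.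
destruct (log_derivative_bound (a x) (b x) a' b' lam Hab Hl) as [m1 [m2 [Ha' [Hb' Hm]]]].
{ rewrite Hs2; exact Hd. }
set (P := (f1 x + b x * e1 x + a x * e2 x, f2 x - a x * e1 x + b x * e2 x) : C).
set (Q := (f1 x - b x * e1 x - a x * e2 x, f2 x + a x * e1 x - b x * e2 x) : C).
assert (HP : Cmod P ^ 2 = refl (a x) (b x) (e1 x) (e2 x) (f1 x) (f2 x)).
{ rewrite Cmod_eq_sqrt, pow2_sqrt; [reflexivity|apply Rplus_le_le_0_compat; apply pow2_ge_0]. }
assert (HQ : Cmod Q ^ 2 = inc (a x) (b x) (e1 x) (e2 x) (f1 x) (f2 x)).
{ rewrite Cmod_eq_sqrt, pow2_sqrt; [reflexivity|apply Rplus_le_le_0_compat; apply pow2_ge_0]. }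
assert (HQ0 : Q <> 0).
{ intros H; rewrite H, Cmod_0 in HQ; lra. }
pose proof (ratio_derivative_bound (m1, m2) P Q lam Hm HQ0) as HB.
rewrite HP, HQ in HB; fold (y x) in HB.
(* This is 2 Re (conj w w') computed from w' = - 2 i k w - M (1 - w^2) with w = P / Q. *)
exists (4 * b x * y x - 2 * Re ((m1, m2) * (Cconj P * Cconj Q * (Q * Q - P * P)))
  / inc (a x) (b x) (e1 x) (e2 x) (f1 x) (f2 x) ^ 2).
split; [|lra].
unfold y; clear HB HP HQ HQ0 y; unfold P, Q; simpl Re; clear P Q.
unfold refl, inc in *.
auto_derive.
- repeat split; try (eexists; eassumption); lra.
- rewrite (is_derive_unique (fun t : R => e1 t) _ _ De1),
    (is_derive_unique (fun t : R => e2 t) _ _ De2),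
    (is_derive_unique (fun t : R => f1 t) _ _ Df1),
    (is_derive_unique (fun t : R => f2 t) _ _ Df2),
    (is_derive_unique (fun t : R => a t) _ _ Da),
    (is_derive_unique (fun t : R => b t) _ _ Db), Ha', Hb', <- Hs1, <- Hs2.
  field; lra.
Qed.

(** * Sectors *)

(** The closed sector 5 pi/8 <= arg <= 7 pi/8 together with 0: the slopes are tan (pi/8) and tan (3
    pi/8). Closedness lets it contain limits of k as well. *)
Definition in_cone (a b : R) : Prop :=
  a <= 0 /\ (sqrt 2 - 1) * - a <= b <= (sqrt 2 + 1) * - a.

Lemma sqrt2_sq : sqrt 2 ^ 2 = 2.
Proof. apply pow2_sqrt; lra. Qed.

Lemma sqrt2_bounds : 1 < sqrt 2 < 3 / 2.
Proof. pose proof sqrt2_sq; pose proof (sqrt_pos 2); split; nra. Qed.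

Lemma pow2_le_inv (x y : R) : 0 <= y -> x ^ 2 <= y ^ 2 -> x <= y.
Proof. intros Hy H; apply Rsqr_incr_0_var; [rewrite !Rsqr_pow2; exact H|exact Hy]. Qed.

Lemma root_in_cone (s1 s2 : R) : Rabs s1 <= - s2 ->
  in_cone (root_re s1 s2) (root_im s1 s2).
Proof.
intros H; unfold in_cone; pose proof (Rabs_pos s1) as H0.
assert (H1 : s1 <= - s2) by (eapply Rle_trans; [apply Rle_abs|exact H]).
assert (H2 : - s1 <= - s2) by (eapply Rle_trans; [apply Rle_abs|rewrite Rabs_Ropp; exact H]).
destruct (root_spec s1 s2) as [Ha [Hb [E1 E2]]]; [lra|].
set (a := root_re s1 s2) in *; set (b := root_im s1 s2) in *.
pose proof sqrt2_sq as Hs; pose proof sqrt2_bounds as Hs'.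
set (r := sqrt 2) in *.
(* (b - a)^2 >= 2 a^2 and (b - a)^2 >= 2 b^2 *)
split; [exact Ha|split].
- assert (r * - a <= b - a); [|lra].
  apply pow2_le_inv; [lra|]; rewrite Rpow_mult_distr, Hs; nra.
- assert (r * b <= b - a); [|nra].
  apply pow2_le_inv; [lra|]; rewrite Rpow_mult_distr, Hs; nra.
Qed.

Lemma tan_3PI8 : tan (3 * PI / 8) = 1 + sqrt 2 /\ 0 < cos (3 * PI / 8).
Proof.
pose proof PI_RGT_0 as HPI.
assert (Hc : 0 < cos (3 * PI / 8)) by (apply cos_gt_0; lra).
assert (Hs : 0 < sin (3 * PI / 8)) by (apply sin_gt_0; lra).
assert (H1 := sin_2a (3 * PI / 8)); assert (H2 := cos_2a (3 * PI / 8)).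
replace (2 * (3 * PI / 8)) with (3 * (PI / 4)) in H1, H2 by lra.
rewrite sin_3PI4 in H1; rewrite cos_3PI4 in H2.
split; [|exact Hc]; unfold tan.
set (c := cos _) in *; set (s := sin _) in *.
apply (Rmult_eq_reg_r c); [|lra].
unfold Rdiv; rewrite Rmult_assoc, Rinv_l, Rmult_1_r by lra.
pose proof sqrt2_sq; pose proof sqrt2_bounds; set (r := sqrt 2) in *.
(* The double angle 3 pi/4 gives s^2 - c^2 = 2 s c, that is (s - c)^2 = 2 c^2. The second factor is
   excluded: it would give s < c, while cos (3 pi/4) < 0 gives s > c. *)
assert (H3 : (s - c - r * c) * (s - c + r * c) = 0).
{ replace ((s - c - r * c) * (s - c + r * c)) with (s ^ 2 - 2 * s * c + c ^ 2 - r ^ 2 * c ^ 2) by ring.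
  rewrite H; replace (-1 / r) with (- (1 / r)) in H2 by (field; lra); lra. }
apply Rmult_integral in H3; destruct H3 as [H3|H3]; [lra|].
assert (0 < s * s - c * c -> False).
{ intros Hx; assert (0 < 1 / r) by (apply Rdiv_lt_0_compat; lra).
  replace (-1 / r) with (- (1 / r)) in H2 by (field; lra).
  assert (s < c) by nra; nra. }
assert (s * s < c * c -> False); [|nra].
intros; assert (0 < 1 / r) by (apply Rdiv_lt_0_compat; lra).
replace (-1 / r) with (- (1 / r)) in H2 by (field; lra); lra.
Qed.

Lemma c0_spec : exists S, c0 = (1 + sqrt 2) + S /\ 0 < S /\ S ^ 2 = 1 + (1 + sqrt 2) ^ 2.
Proof.
destruct tan_3PI8 as [H1 H2]; exists (/ cos (3 * PI / 8)).
unfold c0; rewrite <- H1; split; [reflexivity|].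
split; [now apply Rinv_0_lt_compat|].
unfold tan; apply (Rmult_eq_reg_r (cos (3 * PI / 8) ^ 2)); [|now apply pow_nonzero, Rgt_not_eq].
field_simplify; [|lra|lra].
rewrite <- (sin2_cos2 (3 * PI / 8)); unfold Rsqr; ring.
Qed.

(** Polarization and parallelogram identities for the vectors E' and i k E. The first shows that |w|
    <= 1 amounts to Re (E' conj (i k E)) >= 0. *)
Lemma refl_inc_difference (a b e1 e2 f1 f2 : R) :
  refl a b e1 e2 f1 f2 - inc a b e1 e2 f1 f2 =
  -4 * (a * (e1 * f2 - e2 * f1) - b * (e1 * f1 + e2 * f2)) /\
  refl a b e1 e2 f1 f2 + inc a b e1 e2 f1 f2 =
  2 * (f1 ^ 2 + f2 ^ 2 + (a ^ 2 + b ^ 2) * (e1 ^ 2 + e2 ^ 2)).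
Proof. unfold refl, inc; split; ring. Qed.

(** With T = tan (3 pi/8), S^2 = 1 + T^2 and c0 = T + S, the claim p <= c0^2 n is equivalent to S (p
    - n) <= T (p + n). In p - n the flux term has a favourable sign, as a <= 0 and F <= 0, so only b
    G has to be bounded. *)
Lemma refl_le_c0 (a b e1 e2 f1 f2 : R) :
  in_cone a b -> e1 * f2 - e2 * f1 <= 0 ->
  refl a b e1 e2 f1 f2 <= c0 ^ 2 * inc a b e1 e2 f1 f2.
Proof.
intros [Ha Hb] HF.
destruct c0_spec as [S [-> [HS HS2]]].
destruct (refl_inc_difference a b e1 e2 f1 f2) as [Hd Hs].
pose proof sqrt2_bounds.
assert (HT : 0 < 1 + sqrt 2) by lra; set (T := 1 + sqrt 2) in *.
set (F := e1 * f2 - e2 * f1) in *; set (G := e1 * f1 + e2 * f2) in *.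
set (p := refl _ _ _ _ _ _) in *; set (n := inc _ _ _ _ _ _) in *.
set (X := f1 ^ 2 + f2 ^ 2); set (Y := (a ^ 2 + b ^ 2) * (e1 ^ 2 + e2 ^ 2)).
assert (Hb2 : 0 <= b <= T * - a) by (unfold T; split; nra).
(* In the sector, b / |k| <= T / S = sin (3 pi/8). With Cauchy-Schwarz for G and the inequality
   between geometric and arithmetic mean this bounds S b G. *)
assert (HSb : S ^ 2 * b ^ 2 <= T ^ 2 * (a ^ 2 + b ^ 2)).
{ rewrite HS2; assert (b ^ 2 <= (T * - a) ^ 2) by (apply pow_incr; exact Hb2); lra. }
assert (HX : 0 <= X) by (apply Rplus_le_le_0_compat; apply pow2_ge_0).
assert (HY : 0 <= Y).
{ apply Rmult_le_pos; apply Rplus_le_le_0_compat; apply pow2_ge_0. }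
assert (HG : S * b * G <= T / 2 * (X + Y)).
{ apply pow2_le_inv; [apply Rmult_le_pos; lra|].
  apply Rle_trans with (T ^ 2 * (a ^ 2 + b ^ 2) * ((e1 ^ 2 + e2 ^ 2) * X)).
  - replace ((S * b * G) ^ 2) with (S ^ 2 * b ^ 2 * G ^ 2) by ring.
    apply Rmult_le_compat; [|apply pow2_ge_0|exact HSb|].
    + rewrite <- Rpow_mult_distr; apply pow2_ge_0.
    + unfold G, X; pose proof (pow2_ge_0 F); unfold F in *; lra.
  - replace (T ^ 2 * (a ^ 2 + b ^ 2) * ((e1 ^ 2 + e2 ^ 2) * X))
      with (T ^ 2 * (X * Y)) by (unfold Y; ring).
    pose proof (Rmult_le_pos _ _ (pow2_ge_0 T) (pow2_ge_0 (X - Y))); lra. }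
assert (HaF : 0 <= S * (a * F)) by (apply Rmult_le_pos; nra).
assert (E : (T + S) ^ 2 * n - p = (T + S) * (T * (p + n) - S * (p - n))).
{ replace ((T + S) ^ 2 * n - p)
    with (((T + S) ^ 2 - 1) / 2 * (p + n) - ((T + S) ^ 2 + 1) / 2 * (p - n)) by field.
  replace (((T + S) ^ 2 - 1) / 2) with (T * (T + S)) by lra.
  replace (((T + S) ^ 2 + 1) / 2) with (S * (T + S)) by lra; ring. }
rewrite Hd, Hs in E; fold X Y in E.
assert (0 <= (T + S) * (T * (2 * (X + Y)) - S * (-4 * (a * F - b * G)))); [|lra].
apply Rmult_le_pos; lra.
Qed.

(** The sector has opening pi/4, so k2 conj k1 satisfies Im <= Re; exchanging the indices gives - Im
    <= Re. *)
Lemma in_cone_angle (a1 b1 a2 b2 : R) : in_cone a1 b1 -> in_cone a2 b2 ->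
  b1 * - a2 - b2 * - a1 <= a1 * a2 + b1 * b2.
Proof.
intros [Ha1 Hb1] [Ha2 Hb2].
pose proof sqrt2_sq; pose proof sqrt2_bounds; set (r := sqrt 2) in *.
assert (0 <= b1) by nra; assert (0 <= b2) by nra.
destruct (Rle_dec (- a2) b2) as [H3|H3]; [nra|].
assert (b1 * (- a2 - b2) <= (r + 1) * - a1 * (- a2 - b2))
  by (apply Rmult_le_compat_r; lra).
assert ((r + 1) * (- a2 - b2) <= - a2 + b2) by nra.
nra.
Qed.

(** Index 1 stands for the limit of k from the left, index 2 for its value at the interface. E and
    E' are common to both sides because the field is C^1. Strictness is asked of [a2] only, since
    the last step divides by |k2|^2. *)
Lemma refl_le_inc_of_interface (a1 b1 a2 b2 e1 e2 f1 f2 delta : R) :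
  in_cone a1 b1 -> in_cone a2 b2 -> a2 < 0 -> 0 <= delta <= sqrt 2 - 1 ->
  refl a2 b2 e1 e2 f1 f2 <= delta ^ 2 * inc a2 b2 e1 e2 f1 f2 ->
  refl a1 b1 e1 e2 f1 f2 <= inc a1 b1 e1 e2 f1 f2.
Proof.
intros H1 H2 Ha2 Hdelta H.
assert (J1 := in_cone_angle _ _ _ _ H1 H2); assert (J2 := in_cone_angle _ _ _ _ H2 H1).
destruct (refl_inc_difference a1 b1 e1 e2 f1 f2) as [Hd1 _].
destruct (refl_inc_difference a2 b2 e1 e2 f1 f2) as [Hd Hs].
pose proof sqrt2_sq as Hr; pose proof sqrt2_bounds; set (r := sqrt 2) in *.
set (F := e1 * f2 - e2 * f1) in *; set (G := e1 * f1 + e2 * f2) in *.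
set (p := refl a2 _ _ _ _ _) in *; set (n := inc a2 _ _ _ _ _) in *.
set (U := f1 ^ 2 + f2 ^ 2) in *; set (V := (a2 ^ 2 + b2 ^ 2) * (e1 ^ 2 + e2 ^ 2)) in *.
(* X + i Y and D + i J are E' conj (i k2 E) and k2 conj k1; both have argument
   at most pi/4 in modulus, so that their product has nonnegative real part. *)
set (X := a2 * F - b2 * G) in *; set (Y := - a2 * G - b2 * F).
assert (HU : 0 <= U) by (apply Rplus_le_le_0_compat; apply pow2_ge_0).
assert (HV : 0 <= V).
{ apply Rmult_le_pos; apply Rplus_le_le_0_compat; apply pow2_ge_0. }
assert (HXY : X ^ 2 + Y ^ 2 = U * V) by (unfold X, Y, U, V, F, G; ring).
assert (Hn : 0 <= n) by (apply Rplus_le_le_0_compat; apply pow2_ge_0).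
assert (Hd2 : delta ^ 2 <= (r - 1) ^ 2) by (apply pow_incr; exact Hdelta).
assert (Hp : p <= (r - 1) ^ 2 * n) by nra.
(* For t = sqrt 2 - 1 one has 1 + t^2 = 2 sqrt 2 t and 1 - t^2 = 2 t, so p <= t^2 n is the same as p
   + n <= sqrt 2 (n - p), where n - p = 4 X. *)
assert (HX : U + V <= 2 * r * X).
{ assert ((r - 1) * (U + V) <= (r - 1) * (2 * r * X)) by nra; nra. }
assert (HX0 : 0 <= X) by nra.
assert (HY2 : Y ^ 2 <= X ^ 2).
{ assert ((U + V) ^ 2 <= (2 * r * X) ^ 2) by (apply pow_incr; lra).
  pose proof (pow2_ge_0 (U - V)); nra. }
assert (HY : - X <= Y <= X).
{ apply Rabs_le_between; apply pow2_le_inv; [exact HX0|rewrite pow2_abs; exact HY2]. }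
set (D := a1 * a2 + b1 * b2) in *; set (J := b2 * a1 - a2 * b1).
assert (HJ : - D <= J <= D) by (unfold J, D in *; lra).
assert (E : (a1 * F - b1 * G) * (a2 ^ 2 + b2 ^ 2) = X * D - Y * J)
  by (unfold X, Y, D, J; ring).
assert (0 <= X * D - Y * J) by nra.
assert (0 <= a1 * F - b1 * G) by (apply (Rmult_le_reg_r (a2 ^ 2 + b2 ^ 2)); nra).
lra.
Qed.

(** Together with [ksq_im], the parts of al omega^2 - i be omega. Linearity in (al, be) lets the
    same expressions give the derivative of k^2 from those of the coefficients. *)
Definition ksq_re (al be o1 o2 : R) : R := al * (o1 ^ 2 - o2 ^ 2) + be * o2.
Definition ksq_im (al be o1 o2 : R) : R := 2 * al * o1 * o2 - be * o1.

(** This is where both frequency bounds of condition A come from. With x = - o2 - o1, the bound Im s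
    <= Re s reads al (x^2 - 2 o1^2) + be x <= 0. For x > 0 the largest [be] gives (x + Kc o1)^2 <=
    (2 + Kc^2) o1^2, that is x <= phi(Kc) o1. The bound Re s <= - Im s follows from (o1 - o2)^2 >= 2
    o1^2. *)
Lemma ksq_in_cone (al be o1 o2 Kc : R) : 0 < o1 -> 0 < al -> 0 <= be -> 0 < Kc ->
  be <= 2 * Kc * o1 * al -> - (1 + phi Kc) * o1 <= o2 <= (1 - sqrt 2) * o1 ->
  Rabs (ksq_re al be o1 o2) <= - ksq_im al be o1 o2.
Proof.
intros H1 Hal Hbe HK Hb [Hl Hu].
unfold phi in Hl; unfold ksq_re, ksq_im.
pose proof sqrt2_sq; pose proof sqrt2_bounds; set (r := sqrt 2) in *.
assert (HS : sqrt (2 + Kc ^ 2) ^ 2 = 2 + Kc ^ 2) by (apply pow2_sqrt; nra).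
pose proof (sqrt_pos (2 + Kc ^ 2)); set (S := sqrt (2 + Kc ^ 2)) in *.
assert (Ho : o2 < 0) by nra.
apply Rabs_le; split.
- assert (al * (o2 ^ 2 - o1 ^ 2 + 2 * o1 * o2) + be * (- o2 - o1) <= 0); [|lra].
  assert (Hq : o2 ^ 2 - o1 ^ 2 + 2 * o1 * o2 + 2 * Kc * o1 * (- o2 - o1) <= 0
    \/ - o2 - o1 <= 0).
  { destruct (Rle_dec (- o2 - o1) 0) as [H3|H3]; [now right|left].
    assert (((- o2 - o1) + Kc * o1) ^ 2 <= (S * o1) ^ 2) by (apply pow_incr; nra).
    nra. }
  destruct (Rle_dec (- o2 - o1) 0) as [H3|H3].
  + assert (o2 ^ 2 - o1 ^ 2 + 2 * o1 * o2 <= 0) by nra.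
    nra.
  + destruct Hq as [Hq|Hq]; [|lra].
    assert (be * (- o2 - o1) <= 2 * Kc * o1 * al * (- o2 - o1))
      by (apply Rmult_le_compat_r; lra).
    nra.
- assert (Hq : 0 <= (o1 - o2) ^ 2 - 2 * o1 ^ 2).
  { assert ((r * o1) ^ 2 <= (o1 - o2) ^ 2) by (apply pow_incr; nra).
    rewrite Rpow_mult_distr in *; nra. }
  assert (0 <= al * ((o1 - o2) ^ 2 - 2 * o1 ^ 2)) by nra.
  assert (0 <= be * o1) by nra; assert (be * o2 <= 0) by nra; nra.
Qed.

(** The derivative al' omega^2 - i be' omega has modulus at most |al'| |omega|^2 + |be'| |omega|.
    The weights in condition B are such that this is at most 4 lam o1 |o2| al + 2 lam o1 be = 2 lam
    |Im k^2|. *)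
Lemma ksq_derivative_bound (al be al' be' o1 o2 lam : R) : 0 < o1 -> o2 < 0 ->
  Rabs al' <= 4 * lam * (Rabs (o1 * o2) / Cmod (o1, o2) ^ 2) * al ->
  Rabs be' <= 2 * lam * (o1 / Cmod (o1, o2)) * be ->
  ksq_re al' be' o1 o2 ^ 2 + ksq_im al' be' o1 o2 ^ 2
    <= (2 * lam * ksq_im al be o1 o2) ^ 2.
Proof.
intros H1 H2 Ha Hb.
assert (Hm2 : Cmod (o1, o2) ^ 2 = o1 ^ 2 + o2 ^ 2) by (apply pow2_sqrt; simpl; nra).
assert (Hm : 0 < Cmod (o1, o2)).
{ apply Cmod_gt_0; intros H; injection H; lra. }
assert (Hm3 : - o2 <= Cmod (o1, o2)) by (apply pow2_le_inv; [lra|nra]).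
set (m := Cmod (o1, o2)) in *.
rewrite Rabs_mult, (Rabs_pos_eq o1), (Rabs_left o2) in Ha by lra.
assert (Ha' : Rabs al' * m ^ 2 <= 4 * lam * (o1 * - o2) * al).
{ apply (Rmult_le_compat_r (m ^ 2)) in Ha; [|nra].
  eapply Rle_trans; [exact Ha|]; apply Req_le; field; lra. }
assert (Hb' : Rabs be' * m <= 2 * lam * o1 * be).
{ apply (Rmult_le_compat_r m) in Hb; [|lra].
  eapply Rle_trans; [exact Hb|]; apply Req_le; field; lra. }
apply Rle_trans with ((Rabs al' * m ^ 2 + Rabs be' * m) ^ 2).
- replace (ksq_re al' be' o1 o2 ^ 2 + ksq_im al' be' o1 o2 ^ 2)
    with (al' ^ 2 * (o1 ^ 2 + o2 ^ 2) ^ 2 + be' ^ 2 * (o1 ^ 2 + o2 ^ 2)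
      + 2 * (al' * be') * - o2 * (o1 ^ 2 + o2 ^ 2)) by (unfold ksq_re, ksq_im; ring).
  rewrite <- Hm2, <- (pow2_abs al'), <- (pow2_abs be').
  pose proof (Rle_abs (al' * be')) as H3; rewrite Rabs_mult in H3.
  assert (0 <= Rabs al' * Rabs be') by (apply Rmult_le_pos; apply Rabs_pos).
  assert (al' * be' * - o2 <= Rabs al' * Rabs be' * m) by nra.
  assert (al' * be' * - o2 * m ^ 2 <= Rabs al' * Rabs be' * m * m ^ 2)
    by (apply Rmult_le_compat_r; nra).
  lra.
- replace ((2 * lam * ksq_im al be o1 o2) ^ 2)
    with ((4 * lam * (o1 * - o2) * al + 2 * lam * o1 * be) ^ 2)
    by (unfold ksq_im; ring).
  apply pow_incr; split; [|lra].
  pose proof (Rabs_pos al'); pose proof (Rabs_pos be'); nra.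
Qed.

(** In the sector b >= tan (pi/8) |a|, so b^2 >= |a b| / (sqrt 2 + 1), while conductivity only
    enlarges |a b| = |Im k^2| / 2 >= al o1 |o2|. *)
Lemma root_im_lower_bound (a b al be o1 o2 c X : R) : 0 < c -> 0 <= X ->
  in_cone a b -> 2 * a * b = ksq_im al be o1 o2 -> 0 <= be -> 0 < o1 -> o2 <= 0 ->
  al = X / c ^ 2 ->
  / c * sqrt (X * o1 * Rabs o2 / (sqrt 2 + 1)) <= b.
Proof.
intros Hc HX [Ha Hb] Hs Hbe H1 H2 ->.
pose proof sqrt2_sq; pose proof sqrt2_bounds; set (r := sqrt 2) in *.
assert (Hb0 : 0 <= b) by nra.
apply (Rmult_le_reg_l c); [exact Hc|].
rewrite <- Rmult_assoc, Rinv_r, Rmult_1_l by lra.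
rewrite <- (sqrt_pow2 (c * b)) by (apply Rmult_le_pos; lra).
apply sqrt_le_1_alt.
assert (Hr : / (r + 1) = r - 1) by (apply (Rmult_eq_reg_l (r + 1)); [rewrite Rinv_r; nra|lra]).
unfold Rdiv; rewrite Hr.
assert (Hs2 : X * o1 * o2 * 2 - be * o1 * c ^ 2 = 2 * a * b * c ^ 2).
{ rewrite Hs; unfold ksq_im; field; lra. }
rewrite (Rabs_left1 o2) by exact H2.
assert (0 <= be * o1 * c ^ 2) by (repeat apply Rmult_le_pos; nra).
assert (Hc2 : 0 < c ^ 2) by nra.
assert ((r - 1) * - a * b <= b * b) by (apply Rmult_le_compat_r; lra).
assert ((r - 1) * - a * b * c ^ 2 <= b * b * c ^ 2) by (apply Rmult_le_compat_r; lra).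
assert (X * o1 * - o2 <= - a * b * c ^ 2) by lra.
nra.
Qed.

(** * A single layer *)

(* The field equation E'' + s E = 0 with E = e1 + i e2, E' = f1 + i f2 and
   s = s1 + i s2, on a layer [a, b) where s may jump at b. *)
Record layer_system (a b lam : R) (e1 e2 f1 f2 s1 s2 : R -> R) (s1b s2b : R) : Prop := {
  ls_lt : a < b;
  ls_lam : 0 <= lam;
  ls_e1 : forall x, a < x < b -> is_derive e1 x (f1 x);
  ls_e2 : forall x, a < x < b -> is_derive e2 x (f2 x);
  ls_f1 : forall x, a < x < b -> is_derive f1 x (- (s1 x * e1 x - s2 x * e2 x));
  ls_f2 : forall x, a < x < b -> is_derive f2 x (- (s1 x * e2 x + s2 x * e1 x));
  ls_s : forall x, a < x < b -> exists d1 d2,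
    is_derive s1 x d1 /\ is_derive s2 x d2 /\ d1 ^ 2 + d2 ^ 2 <= (2 * lam * s2 x) ^ 2;
  ls_neg : forall x, a <= x < b -> s2 x < 0;
  ls_cone : forall x, a <= x < b -> Rabs (s1 x) <= - s2 x;
  ls_e1a : filterlim e1 (at_right a) (locally (e1 a));
  ls_e2a : filterlim e2 (at_right a) (locally (e2 a));
  ls_f1a : filterlim f1 (at_right a) (locally (f1 a));
  ls_f2a : filterlim f2 (at_right a) (locally (f2 a));
  ls_s1a : filterlim s1 (at_right a) (locally (s1 a));
  ls_s2a : filterlim s2 (at_right a) (locally (s2 a));
  ls_e1b : filterlim e1 (at_left b) (locally (e1 b));
  ls_e2b : filterlim e2 (at_left b) (locally (e2 b));
  ls_f1b : filterlim f1 (at_left b) (locally (f1 b));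
  ls_f2b : filterlim f2 (at_left b) (locally (f2 b));
  ls_s1b : filterlim s1 (at_left b) (locally s1b);
  ls_s2b : filterlim s2 (at_left b) (locally s2b)
}.

Definition flux (e1 e2 f1 f2 : R -> R) (x : R) : R := e1 x * f2 x - e2 x * f1 x.

(** This is |w|^2, written through s = k^2 so that its one-sided limits follow from those of s. At
    an interface its value belongs to the layer on the right. *)
Definition ratio (e1 e2 f1 f2 s1 s2 : R -> R) (x : R) : R :=
  refl (root_re (s1 x) (s2 x)) (root_im (s1 x) (s2 x)) (e1 x) (e2 x) (f1 x) (f2 x) /
  inc (root_re (s1 x) (s2 x)) (root_im (s1 x) (s2 x)) (e1 x) (e2 x) (f1 x) (f2 x).

Lemma filterlim_ratio (F : (R -> Prop) -> Prop) {FF : Filter F}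
  (e1 e2 f1 f2 s1 s2 : R -> R) (E1 E2 F1 F2 S1 S2 : R) :
  filterlim e1 F (locally E1) -> filterlim e2 F (locally E2) ->
  filterlim f1 F (locally F1) -> filterlim f2 F (locally F2) ->
  filterlim s1 F (locally S1) -> filterlim s2 F (locally S2) ->
  inc (root_re S1 S2) (root_im S1 S2) E1 E2 F1 F2 <> 0 ->
  filterlim (ratio e1 e2 f1 f2 s1 s2) F
    (locally (refl (root_re S1 S2) (root_im S1 S2) E1 E2 F1 F2 /
              inc (root_re S1 S2) (root_im S1 S2) E1 E2 F1 F2)).
Proof.
intros; unfold ratio; refine (filterlim_Rdiv _ _ _ _ _ _ _ _); [assumption|..];
  unfold refl, inc, root_re, root_im; real_filterlim; lra.
Qed.

(** The derivative of conj E E' is |E'|^2 - s |E|^2, with imaginary part - s2 |E|^2 >= 0. *)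
Lemma layer_flux_le (a b lam : R) (e1 e2 f1 f2 s1 s2 : R -> R) (s1b s2b : R) :
  layer_system a b lam e1 e2 f1 f2 s1 s2 s1b s2b ->
  forall x, a <= x < b -> flux e1 e2 f1 f2 x <= flux e1 e2 f1 f2 b.
Proof.
intros []; apply nondecreasing_left_limit; [assumption| |unfold flux; real_filterlim..].
intros x Hx; exists (- s2 x * (e1 x ^ 2 + e2 x ^ 2)); split.
- assert (H1 := ls_e3 x Hx); assert (H2 := ls_e4 x Hx).
  assert (H3 := ls_f3 x Hx); assert (H4 := ls_f4 x Hx).
  unfold flux; auto_derive; [repeat split; eexists; eassumption|].
  rewrite (is_derive_unique (fun t : R => e1 t) _ _ H1),
    (is_derive_unique (fun t : R => e2 t) _ _ H2),
    (is_derive_unique (fun t : R => f1 t) _ _ H3),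
    (is_derive_unique (fun t : R => f2 t) _ _ H4); ring.
- assert (s2 x < 0) by (apply ls_neg0; lra).
  apply Rmult_le_pos; [lra|apply Rplus_le_le_0_compat; apply pow2_ge_0].
Qed.

Lemma sum_squares_zero (p q r s : R) : p ^ 2 + q ^ 2 + r ^ 2 + s ^ 2 <= 0 ->
  p = 0 /\ q = 0 /\ r = 0 /\ s = 0.
Proof.
intros H; pose proof (pow2_ge_0 p); pose proof (pow2_ge_0 q);
pose proof (pow2_ge_0 r); pose proof (pow2_ge_0 s).
repeat split; apply Rsqr_0_uniq; rewrite Rsqr_pow2; lra.
Qed.

(** The right side is the derivative of |E|^2 + |E'|^2 along E'' = - s E. Its products of E with E'
    are controlled by the energy, with weights 1, |s1| <= M and |s2| <= M. *)
Lemma energy_derivative_bound (e1 e2 f1 f2 s1 s2 M : R) :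
  Rabs s1 <= - s2 -> - s2 <= M ->
  - (2 * M + 1) * (e1 ^ 2 + e2 ^ 2 + f1 ^ 2 + f2 ^ 2) <=
  2 * (e1 * f1 + e2 * f2 - f1 * (s1 * e1 - s2 * e2) - f2 * (s1 * e2 + s2 * e1)).
Proof.
intros H HM; pose proof (Rabs_pos s1); apply Rabs_le_between in H.
assert (H1 : - (e1 ^ 2 + f1 ^ 2 + e2 ^ 2 + f2 ^ 2) <= 2 * (e1 * f1 + e2 * f2))
  by (pose proof (pow2_ge_0 (e1 + f1)); pose proof (pow2_ge_0 (e2 + f2)); lra).
set (G := e1 ^ 2 + e2 ^ 2 + f1 ^ 2 + f2 ^ 2) in *.
assert (HG : 0 <= G) by (unfold G; repeat apply Rplus_le_le_0_compat; apply pow2_ge_0).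
set (X := 2 * (f1 * e1 + f2 * e2)); set (Y := 2 * (f1 * e2 - f2 * e1)).
assert (HX : - G <= X <= G).
{ unfold X, G; split.
  - pose proof (pow2_ge_0 (e1 + f1)); pose proof (pow2_ge_0 (e2 + f2)); lra.
  - pose proof (pow2_ge_0 (e1 - f1)); pose proof (pow2_ge_0 (e2 - f2)); lra. }
assert (HY : - G <= Y <= G).
{ unfold Y, G; split.
  - pose proof (pow2_ge_0 (f1 + e2)); pose proof (pow2_ge_0 (f2 - e1)); lra.
  - pose proof (pow2_ge_0 (f1 - e2)); pose proof (pow2_ge_0 (f2 + e1)); lra. }
assert (H2 : s1 * X <= M * G) by nra.
assert (H3 : - s2 * Y <= M * G) by nra.
unfold X, Y, G in *; lra.
Qed.

Lemma layer_zero_field (a b lam : R) (e1 e2 f1 f2 s1 s2 : R -> R) (s1b s2b : R) :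
  layer_system a b lam e1 e2 f1 f2 s1 s2 s1b s2b ->
  e1 b = 0 -> e2 b = 0 -> f1 b = 0 -> f2 b = 0 ->
  forall x, a <= x < b -> e1 x = 0 /\ e2 x = 0 /\ f1 x = 0 /\ f2 x = 0.
Proof.
intros [] E1 E2 E3 E4 x Hx.
(* Boundedness of s on the half-open layer: |s'| <= 2 lam |s2| lets Gronwall run backward from the
   finite limit [s2b]. *)
assert (HM : exists M, forall t, a <= t < b -> - s2 t <= M).
{ exists (exp (2 * lam * (b - a)) * Rabs s2b); intros t Ht.
  apply Rle_trans with (0 + exp (- (- (2 * lam)) * (b - t)) * (- s2b - 0)).
  - apply (gronwall_backward (fun u => - s2 u) a b (- s2b) (- (2 * lam)) 0);
      [assumption| |real_filterlim..|assumption].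
    intros u Hu; destruct (ls_s0 u Hu) as [d1 [d2 [H1 [H2 H3]]]].
    exists (- d2); split; [now apply (is_derive_opp s2)|].
    assert (s2 u < 0) by (apply ls_neg0; lra).
    assert (d2 <= 2 * lam * - s2 u); [|lra].
    apply pow2_le_inv; [nra|]; pose proof (pow2_ge_0 d1); lra.
  - rewrite Rplus_0_l, Rminus_0_r, Ropp_involutive.
    assert (H1 : exp (2 * lam * (b - t)) <= exp (2 * lam * (b - a))).
    { destruct (Req_dec (2 * lam * (b - t)) (2 * lam * (b - a))) as [->|H]; [lra|].
      apply Rlt_le, exp_increasing; nra. }
    pose proof (exp_pos (2 * lam * (b - t))).
    pose proof (Rle_abs (- s2b)) as H2; rewrite Rabs_Ropp in H2.
    pose proof (Rabs_pos s2b); nra. }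
destruct HM as [M HM].
apply sum_squares_zero.
apply Rle_trans with (0 + exp (- (- (2 * M + 1)) * (b - x)) *
  (e1 b ^ 2 + e2 b ^ 2 + f1 b ^ 2 + f2 b ^ 2 - 0)).
2: { rewrite E1, E2, E3, E4; lra. }
apply (gronwall_backward (fun u => e1 u ^ 2 + e2 u ^ 2 + f1 u ^ 2 + f2 u ^ 2)
  a b _ (- (2 * M + 1)) 0); [assumption| |real_filterlim..|assumption].
intros u Hu.
assert (H1 := ls_e3 u Hu); assert (H2 := ls_e4 u Hu).
assert (H3 := ls_f3 u Hu); assert (H4 := ls_f4 u Hu).
eexists; split.
- auto_derive; [repeat split; eexists; eassumption|reflexivity].
- rewrite (is_derive_unique (fun t : R => e1 t) _ _ H1),
    (is_derive_unique (fun t : R => e2 t) _ _ H2),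
    (is_derive_unique (fun t : R => f1 t) _ _ H3),
    (is_derive_unique (fun t : R => f2 t) _ _ H4).
  assert (H5 := energy_derivative_bound (e1 u) (e2 u) (f1 u) (f2 u) (s1 u) (s2 u) M).
  specialize (H5 (ls_cone0 u ltac:(lra)) (HM u ltac:(lra))); lra.
Qed.

Lemma layer_limit_in_cone (a b lam : R) (e1 e2 f1 f2 s1 s2 : R -> R) (s1b s2b : R) :
  layer_system a b lam e1 e2 f1 f2 s1 s2 s1b s2b -> Rabs s1b <= - s2b.
Proof.
intros [].
assert (H0 : 0 <= - s2b - Rabs s1b); [|lra].
apply (filterlim_ge_const (at_left b) (fun t => - s2 t - Rabs (s1 t))).
- refine (filterlim_Rminus _ _ _ _ _ _ _); [real_filterlim|].
  exact (filterlim_continuous _ Rabs _ _ (continuous_Rabs s1b) ls_s1b0).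
- generalize (at_left_interval a b ls_lt0); apply filter_imp; intros t Ht.
  assert (H := ls_cone0 t ltac:(lra)); lra.
Qed.

Lemma layer_ratio_bounds (a b lam A : R) (e1 e2 f1 f2 s1 s2 : R -> R) (s1b s2b : R) :
  layer_system a b lam e1 e2 f1 f2 s1 s2 s1b s2b -> 0 < A ->
  (forall x, a <= x <= b -> flux e1 e2 f1 f2 x < 0) ->
  (forall x, a < x < b -> A <= 4 * root_im (s1 x) (s2 x) - c0 * lam) ->
  refl (root_re s1b s2b) (root_im s1b s2b) (e1 b) (e2 b) (f1 b) (f2 b) <=
  inc (root_re s1b s2b) (root_im s1b s2b) (e1 b) (e2 b) (f1 b) (f2 b) ->
  (exists l, filterlim (ratio e1 e2 f1 f2 s1 s2) (at_left b) (locally l) /\ l <= 1) /\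
  (forall x, a <= x < b -> ratio e1 e2 f1 f2 s1 s2 x <= (1 + lam / A) ^ 2) /\
  ratio e1 e2 f1 f2 s1 s2 a <= exp (- A * (b - a)) + lam / A * (1 + lam / A).
Proof.
intros Hsys HA HF Hrate Hb.
assert (Hcone := layer_limit_in_cone _ _ _ _ _ _ _ _ _ _ _ Hsys).
destruct Hsys.
assert (Hincb : 0 < inc (root_re s1b s2b) (root_im s1b s2b) (e1 b) (e2 b) (f1 b) (f2 b)).
{ apply inc_pos; [|apply HF; lra].
  apply root_in_cone, Hcone. }
assert (Hinc : forall x, a <= x < b -> 0 < inc (root_re (s1 x) (s2 x))
  (root_im (s1 x) (s2 x)) (e1 x) (e2 x) (f1 x) (f2 x)).
{ intros x Hx; apply inc_pos; [|apply HF; lra].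
  apply root_in_cone, ls_cone0, Hx. }
assert (Hlim : exists l, filterlim (ratio e1 e2 f1 f2 s1 s2) (at_left b) (locally l) /\ l <= 1).
{ exists (refl (root_re s1b s2b) (root_im s1b s2b) (e1 b) (e2 b) (f1 b) (f2 b) /
    inc (root_re s1b s2b) (root_im s1b s2b) (e1 b) (e2 b) (f1 b) (f2 b)); split.
  - apply filterlim_ratio; try assumption; [apply at_left_proper_filter|lra].
  - apply (Rmult_le_reg_r _ _ _ Hincb).
    unfold Rdiv; rewrite Rmult_assoc, Rinv_l; lra. }
split; [exact Hlim|]; destruct Hlim as [l [Hl Hl1]].
apply (layer_decay _ a b l A lam); try assumption.
- intros x Hx; assert (Hi := Hinc x ltac:(lra)).
  assert (Hcx := ls_cone0 x ltac:(lra)); assert (Hnx := ls_neg0 x ltac:(lra)).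
  assert (Hy0 : 0 <= ratio e1 e2 f1 f2 s1 s2 x)
    by (apply Rdiv_le_0_compat; [apply refl_pos|exact Hi]).
  split; [exact Hy0|].
  destruct (ls_s0 x Hx) as [d1 [d2 [D1 [D2 D3]]]].
  destruct (root_derive s1 s2 x d1 d2 D1 D2 Hnx) as [a' [b' [Ra [Rb [R1 R2]]]]].
  destruct (root_spec (s1 x) (s2 x)) as [_ [_ [Q1 Q2]]]; [lra|].
  assert (HD := ratio_derive (fun t => root_re (s1 t) (s2 t))
    (fun t => root_im (s1 t) (s2 t)) e1 e2 f1 f2 x a' b' (s1 x) (s2 x) lam
    (ls_e3 x Hx) (ls_e4 x Hx) (ls_f3 x Hx) (ls_f4 x Hx) Ra Rb
    (root_strict _ _ Hnx) Q1 Q2 ls_lam0).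
  cbv beta in HD; rewrite R1, R2 in HD; specialize (HD D3 Hi).
  destruct HD as [d [HD1 HD2]]; exists d; split; [exact HD1|].
  change (4 * root_im (s1 x) (s2 x) * ratio e1 e2 f1 f2 s1 s2 x -
    lam * sqrt (ratio e1 e2 f1 f2 s1 s2 x) * (1 + ratio e1 e2 f1 f2 s1 s2 x) <= d) in HD2.
  (* The sector bound sqrt y <= c0 turns lam sqrt y y into c0 lam y, which the rate hypothesis
     absorbs; only the term lam sqrt y is left. *)
  assert (Hc : ratio e1 e2 f1 f2 s1 s2 x <= c0 ^ 2).
  { apply (Rmult_le_reg_r _ _ _ Hi).
    unfold ratio, Rdiv; rewrite Rmult_assoc, Rinv_l, Rmult_1_r by lra.
    apply refl_le_c0; [now apply root_in_cone|].
    apply Rlt_le, HF; lra. }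
  set (y := ratio e1 e2 f1 f2 s1 s2 x) in *.
  assert (Hc0 : 0 < c0).
  { destruct c0_spec as [S [-> [HS _]]]; pose proof (sqrt_pos 2); lra. }
  assert (Hs : sqrt y <= c0).
  { rewrite <- (sqrt_pow2 c0) by lra; now apply sqrt_le_1_alt. }
  pose proof (sqrt_pos y).
  assert (H1 : lam * (sqrt y * y) <= lam * (c0 * y)).
  { apply Rmult_le_compat_l; [assumption|]; apply Rmult_le_compat_r; assumption. }
  assert (H2 : A * y <= (4 * root_im (s1 x) (s2 x) - c0 * lam) * y)
    by (apply Rmult_le_compat_r; [assumption|now apply Hrate]).
  lra.
- assert (Hia := Hinc a ltac:(lra)).
  apply filterlim_ratio; try assumption; [apply at_right_proper_filter|lra].
Qed.

(** * The layered medium *)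

Lemma filterlim_within_sub {T U : Type} (F : (T -> Prop) -> Prop) {FF : Filter F}
  (D P : T -> Prop) (f : T -> U) (G : (U -> Prop) -> Prop) :
  within P F D -> filterlim f (within D F) G -> filterlim f (within P F) G.
Proof.
intros HD H Q HQ; assert (HQ' : F (fun t => D t -> Q (f t))) by exact (H Q HQ).
unfold within in HD; unfold filtermap, within.
generalize (filter_and (F := F) _ _ HD HQ').
apply filter_imp; intros t [H1 H2] Ht; exact (H2 (H1 Ht)).
Qed.

Lemma is_derive_interior_within {V : NormedModule R_AbsRing}
  (D : R -> Prop) (f : R -> V) (x : R) (l : V) :
  locally x D -> is_derive f x l -> is_derive_within D f x l.
Proof.
intros HD [Hl Hd]; split; [exact Hl|].
intros y Hy e; apply (filter_le_within D), Hd.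
intros P HP; generalize (filter_and _ _ HD (Hy P HP)).
apply filter_imp; intros t [H1 H2]; exact (H2 H1).
Qed.

Lemma smooth_on_interior (D : R -> Prop) (f : R -> R) (x : R) :
  smooth_on D f -> locally x D ->
  exists d, is_derive f x d /\ is_derive_within D f x d.
Proof.
intros [d [d0 d1]] HD; exists (d 1%nat x).
assert (H : is_derive f x (d 1%nat x)).
{ apply (is_derive_ext_loc (d 0%nat)).
  - revert HD; apply filter_imp; exact d0.
  - apply (is_derive_within_interior D); [exact HD|].
    apply d1, (locally_singleton _ _ HD). }
split; [exact H|now apply is_derive_interior_within].
Qed.

Lemma smooth_on_continuous (D : R -> Prop) (f : R -> R) (x : R) :
  smooth_on D f -> D x -> filterlim f (within D (locally x)) (locally (f x)).
Proof.
intros [d [d0 d1]] HD; rewrite <- (d0 x HD).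
apply (filterlim_within_ext D (d 0%nat) f d0).
apply is_derive_within_filterlim with (1 := d1 0%nat x HD).
Qed.

Lemma interface_le (N : nat) (z : nat -> R) (L : R) (eps sigma : R -> R) :
  layered_medium N z L eps sigma ->
  forall i j, (i <= j)%nat -> (j <= N)%nat -> z i <= z j.
Proof.
intros HM i j Hij; induction Hij as [|j Hij IH]; intros Hj; [lra|].
assert (H := lm_incr _ _ _ _ _ HM j ltac:(lia)); specialize (IH ltac:(lia)); lra.
Qed.

Lemma layer_bounds (N : nat) (z : nat -> R) (L : R) (eps sigma : R -> R) :
  layered_medium N z L eps sigma ->
  forall j, (1 <= j <= N)%nat -> 0 <= z (pred j) /\ z (pred j) < z j <= L.
Proof.
intros HM j Hj; assert (HI := interface_le _ _ _ _ _ HM).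
assert (H0 := HI 0%nat (pred j) ltac:(lia) ltac:(lia)).
assert (HN := HI j N ltac:(lia) ltac:(lia)).
assert (H1 := lm_incr _ _ _ _ _ HM (pred j) ltac:(lia)).
rewrite (lm_z0 _ _ _ _ _ HM) in H0; rewrite (lm_zN _ _ _ _ _ HM) in HN.
replace (S (pred j)) with j in H1 by lia; lra.
Qed.

Lemma backward_layer_ind (N : nat) (z : nat -> R) (L : R) (eps sigma : R -> R)
  (P : R -> Prop) : layered_medium N z L eps sigma -> P L ->
  (forall j, (1 <= j <= N)%nat -> P (z j) -> forall x, z (pred j) <= x < z j -> P x) ->
  forall x, 0 <= x <= L -> P x.
Proof.
intros HM HL Hstep.
assert (H : forall m, (m <= N)%nat -> forall x, z (N - m)%nat <= x <= L -> P x).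
{ induction m as [|m IH]; intros Hm x Hx.
  - replace (N - 0)%nat with N in Hx by lia; rewrite (lm_zN _ _ _ _ _ HM) in Hx.
    replace x with L by lra; exact HL.
  - destruct (Rle_dec (z (N - m)%nat) x) as [H|H]; [apply IH; [lia|lra]|].
    apply (Hstep (N - m)%nat); [lia| |].
    + apply IH; [lia|].
      destruct (layer_bounds _ _ _ _ _ HM (N - m)%nat); [lia|]; lra.
    + replace (pred (N - m)) with (N - S m)%nat by lia; lra. }
intros x Hx; apply (H N (le_n N)).
rewrite Nat.sub_diag, (lm_z0 _ _ _ _ _ HM); exact Hx.
Qed.

Lemma kz_sq_components (c mu0 mu : R) (eps sigma : R -> R) (o1 o2 x : R) :
  Re (kz_sq c mu0 mu eps sigma (o1, o2) x) =
    ksq_re (mu * eps x / c ^ 2) (mu0 * mu * sigma x) o1 o2 /\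
  Im (kz_sq c mu0 mu eps sigma (o1, o2) x) =
    ksq_im (mu * eps x / c ^ 2) (mu0 * mu * sigma x) o1 o2.
Proof. unfold kz_sq, ksq_re, ksq_im; simpl; split; unfold Rdiv; ring. Qed.

Lemma ksq_im_neg (al be o1 o2 : R) : 0 < al -> 0 <= be -> 0 < o1 -> o2 < 0 ->
  ksq_im al be o1 o2 < 0.
Proof.
intros; unfold ksq_im.
assert (0 < al * (o1 * - o2)) by (repeat apply Rmult_lt_0_compat; lra).
assert (0 <= be * o1) by (apply Rmult_le_pos; lra); lra.
Qed.

Lemma layer_system_of_medium (c mu0 mu : R) (N : nat) (z : nat -> R) (L : R)
  (eps sigma : R -> R) (o1 o2 : R) (k : R -> C) (h : C) (zs : R) (E dE : R -> C)
  (delta : R) (K lambda : nat -> R) (j : nat) :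
  0 < c -> 0 < mu0 -> 0 < mu -> 0 < o1 -> o2 < 0 ->
  layered_medium N z L eps sigma ->
  field_solution c mu0 mu N z L eps sigma (o1, o2) k h zs E dE ->
  condition_A c mu0 L eps sigma o1 o2 ->
  condition_B c mu N z eps sigma o1 o2 delta K lambda ->
  (1 <= j <= N)%nat ->
  exists s1b s2b, layer_system (z (pred j)) (z j) (lambda j)
    (fun x => Re (E x)) (fun x => Im (E x)) (fun x => Re (dE x)) (fun x => Im (dE x))
    (fun x => ksq_re (mu * eps x / c ^ 2) (mu0 * mu * sigma x) o1 o2)
    (fun x => ksq_im (mu * eps x / c ^ 2) (mu0 * mu * sigma x) o1 o2) s1b s2b.
Proof.
intros Hc Hmu0 Hmu H1 H2 HM HE HA [_ HB] Hj.
destruct (layer_bounds _ _ _ _ _ HM j Hj) as [Hz0 [Hz1 Hz2]].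
destruct (HB j Hj) as [HBx _]; clear HB.
set (a := z (pred j)) in *; set (b := z j) in *.
assert (Hlay : forall x, layer N z j x <-> a <= x < b).
{ intros x; unfold layer; split; intros [G1 G2]; split; auto; apply G2; lia. }
assert (Hlayloc : forall x, a < x < b -> locally x (layer N z j)).
{ intros x Hx; generalize (locally_open_interval a b x Hx); apply filter_imp.
  intros t Ht; apply Hlay; lra. }
assert (Hlayr : at_right a (layer N z j)).
{ generalize (at_right_interval a b Hz1); apply filter_imp.
  intros t Ht; apply Hlay; lra. }
assert (Hr : at_right a (fun y => 0 <= y <= L)).
{ generalize (at_right_interval a b Hz1); apply filter_imp; intros t Ht; lra. }
assert (Hl : at_left b (fun y => 0 <= y <= L)).
{ generalize (at_left_interval a b Hz1); apply filter_imp; intros t Ht; lra. }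
assert (Heps := lm_eps_smooth _ _ _ _ _ HM j Hj).
assert (Hsig := lm_sigma_smooth _ _ _ _ _ HM j Hj).
destruct (lm_eps_lim _ _ _ _ _ HM j Hj) as [leps Hleps].
destruct (lm_sigma_lim _ _ _ _ _ HM j Hj) as [lsig Hlsig].
assert (Hepsr : filterlim eps (at_right a) (locally (eps a))).
{ apply (filterlim_within_sub _ (layer N z j)); [exact Hlayr|].
  apply smooth_on_continuous; [exact Heps|apply Hlay; lra]. }
assert (Hsigr : filterlim sigma (at_right a) (locally (sigma a))).
{ apply (filterlim_within_sub _ (layer N z j)); [exact Hlayr|].
  apply smooth_on_continuous; [exact Hsig|apply Hlay; lra]. }
assert (Hal : forall x, 0 <= x -> 0 < mu * eps x / c ^ 2).
{ intros x Hx; apply Rdiv_lt_0_compat; [|now apply pow_lt].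
  apply Rmult_lt_0_compat; [assumption|now apply (lm_eps_pos _ _ _ _ _ HM)]. }
assert (Hbe : forall x, 0 <= x -> 0 <= mu0 * mu * sigma x).
{ intros x Hx; apply Rmult_le_pos; [nra|now apply (lm_sigma_nneg _ _ _ _ _ HM)]. }
exists (ksq_re (mu * leps / c ^ 2) (mu0 * mu * lsig) o1 o2),
  (ksq_im (mu * leps / c ^ 2) (mu0 * mu * lsig) o1 o2).
assert (Hc2 : c ^ 2 <> 0) by (apply pow_nonzero; lra).
assert (Ha0 : 0 <= a <= L) by lra.
assert (Hb0 : 0 <= b <= L) by lra.
assert (HEc : forall x, 0 <= x <= L ->
  filterlim E (within (fun y => 0 <= y <= L) (locally x)) (locally (E x))).
{ intros x Hx; exact (is_derive_within_filterlim _ _ _ _ (fs_derive _ _ _ _ _ _ _ _ _ _ _ _ _ _ HE x Hx)). }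
assert (HdEc := fs_C1 _ _ _ _ _ _ _ _ _ _ _ _ _ _ HE).
destruct (filterlim_C_components _ _ _
  (filterlim_within_sub _ _ _ _ _ Hr (HEc a Ha0))) as [E1a E2a].
destruct (filterlim_C_components _ _ _
  (filterlim_within_sub _ _ _ _ _ Hl (HEc b Hb0))) as [E1b E2b].
destruct (filterlim_C_components _ _ _
  (filterlim_within_sub _ _ _ _ _ Hr (HdEc a Ha0))) as [F1a F2a].
destruct (filterlim_C_components _ _ _
  (filterlim_within_sub _ _ _ _ _ Hl (HdEc b Hb0))) as [F1b F2b].
assert (HE' : forall x, a < x < b ->
  is_derive (fun t => Re (E t)) x (Re (dE x)) /\ is_derive (fun t => Im (E t)) x (Im (dE x))).
{ intros x Hx; apply is_derive_C_components.
  apply (is_derive_within_interior (fun y => 0 <= y <= L)).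
  - generalize (locally_open_interval a b x Hx); apply filter_imp; intros t Ht; lra.
  - apply (fs_derive _ _ _ _ _ _ _ _ _ _ _ _ _ _ HE); lra. }
assert (HdE' : forall x, a < x < b ->
  let s1 := ksq_re (mu * eps x / c ^ 2) (mu0 * mu * sigma x) o1 o2 in
  let s2 := ksq_im (mu * eps x / c ^ 2) (mu0 * mu * sigma x) o1 o2 in
  is_derive (fun t => Re (dE t)) x (- (s1 * Re (E x) - s2 * Im (E x))) /\
  is_derive (fun t => Im (dE t)) x (- (s1 * Im (E x) + s2 * Re (E x)))).
{ intros x Hx s1 s2.
  destruct (fs_ode _ _ _ _ _ _ _ _ _ _ _ _ _ _ HE j x Hj) as [ddE [D1 D2]].
  { apply Hlay; lra. }
  destruct (kz_sq_components c mu0 mu eps sigma o1 o2 x) as [Q1 Q2].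
  fold s1 in Q1; fold s2 in Q2.
  set (s := kz_sq _ _ _ _ _ _ _) in *.
  assert (R1 : Re ddE + (Re s * Re (E x) - Im s * Im (E x)) = 0) by exact (f_equal Re D2).
  assert (R2 : Im ddE + (Re s * Im (E x) + Im s * Re (E x)) = 0) by exact (f_equal Im D2).
  rewrite Q1, Q2 in R1, R2.
  replace (- (s1 * Re (E x) - s2 * Im (E x))) with (Re ddE) by lra.
  replace (- (s1 * Im (E x) + s2 * Re (E x))) with (Im ddE) by lra.
  apply is_derive_C_components.
  apply (is_derive_within_interior (layer N z j)); [now apply Hlayloc|exact D1]. }
assert (Hder : forall x, a < x < b -> exists d1 d2, is_derive eps x d1 /\ is_derive sigma x d2 /\
  Rabs d1 <= 4 * lambda j * (Rabs (o1 * o2) / Cmod (o1, o2) ^ 2) * eps x /\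
  Rabs d2 <= 2 * lambda j * (o1 / Cmod (o1, o2)) * sigma x).
{ intros x Hx.
  destruct (smooth_on_interior _ _ x Heps (Hlayloc x Hx)) as [d1 [G1 G2]].
  destruct (smooth_on_interior _ _ x Hsig (Hlayloc x Hx)) as [d2 [G3 G4]].
  assert (Hx' : layer N z j x) by (apply Hlay; lra).
  destruct (HBx x Hx') as [B1 [B2 _]].
  exists d1, d2; split; [exact G1|]; split; [exact G3|].
  split; [now apply B1|now apply B2]. }
assert (Hm : 0 < Cmod (o1, o2)).
{ apply Cmod_gt_0; intros H; injection H; lra. }
destruct HA as [Kc [HKc [HKs Hom]]].
constructor; try assumption; try (intros; now apply HE'); try (intros; now apply HdE').
(* Nonnegativity of [lambda j] is read off at one interior point: there |eps'| is at most [lambda j]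
   times a positive number. *)
- assert (Hab : a < (a + b) / 2 < b) by lra.
  destruct (Hder _ Hab) as [d1 [d2 [_ [_ [Hd _]]]]].
  assert (He : 0 < eps ((a + b) / 2)) by (apply (lm_eps_pos _ _ _ _ _ HM); lra).
  assert (Hq : 0 < Rabs (o1 * o2) / Cmod (o1, o2) ^ 2).
  { apply Rdiv_lt_0_compat; [apply Rabs_pos_lt; nra|now apply pow_lt]. }
  set (X := _ / _) in Hd, Hq.
  pose proof (Rabs_pos d1).
  assert (0 < X * eps ((a + b) / 2)) by (apply Rmult_lt_0_compat; assumption).
  nra.
- intros x Hx; destruct (Hder x Hx) as [d1 [d2 [G1 [G2 [G3 G4]]]]].
  exists (ksq_re (mu * d1 / c ^ 2) (mu0 * mu * d2) o1 o2),
    (ksq_im (mu * d1 / c ^ 2) (mu0 * mu * d2) o1 o2).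
  split; [|split].
  + unfold ksq_re; auto_derive; [repeat split; try (eexists; eassumption); lra|].
    rewrite (is_derive_unique (fun t : R => eps t) _ _ G1),
      (is_derive_unique (fun t : R => sigma t) _ _ G2); field; lra.
  + unfold ksq_im; auto_derive; [repeat split; try (eexists; eassumption); lra|].
    rewrite (is_derive_unique (fun t : R => eps t) _ _ G1),
      (is_derive_unique (fun t : R => sigma t) _ _ G2); field; lra.
  + apply ksq_derivative_bound; try assumption.
    * replace (mu * d1 / c ^ 2) with (mu / c ^ 2 * d1) by (field; lra).
      assert (Hp : 0 < mu / c ^ 2) by (apply Rdiv_lt_0_compat; [assumption|now apply pow_lt]).
      rewrite Rabs_mult, (Rabs_pos_eq (mu / c ^ 2)) by lra.
      apply (Rmult_le_compat_l (mu / c ^ 2)) in G3; [|lra].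
      eapply Rle_trans; [exact G3|]; apply Req_le; field; lra.
    * rewrite Rabs_mult, (Rabs_pos_eq (mu0 * mu)) by nra.
      apply (Rmult_le_compat_l (mu0 * mu)) in G4; [|nra].
      eapply Rle_trans; [exact G4|]; apply Req_le; field; lra.
- intros x Hx; apply ksq_im_neg; try assumption; [apply Hal|apply Hbe]; lra.
- intros x Hx; apply (ksq_in_cone _ _ _ _ Kc); try assumption; [apply Hal; lra|apply Hbe; lra|].
  assert (Hs := HKs x ltac:(lra)).
  assert (He : 0 < eps x) by (apply (lm_eps_pos _ _ _ _ _ HM); lra).
  assert (Hp : 0 < mu0 * mu * eps x) by (repeat apply Rmult_lt_0_compat; assumption).
  apply (Rmult_le_compat_l (mu0 * mu * eps x)) in Hs; [|lra].
  replace (mu0 * mu * sigma x) with (mu0 * mu * eps x * (sigma x / eps x)) by (field; lra).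
  eapply Rle_trans; [exact Hs|]; apply Req_le; field; lra.
- unfold ksq_re; real_filterlim.
- unfold ksq_im; real_filterlim.
- unfold ksq_re; real_filterlim.
- unfold ksq_im; real_filterlim.
Qed.

(** As E' = i k E u, passing from u - 1 and u + 1 to E' - i k E and E' + i k E multiplies both by
    the nonzero factor i k E. *)
Lemma w_as_quotient (E dE k : C) : E <> 0 -> k <> 0 -> (dE + Ci * k * E <> 0)%C ->
  ((- Ci * (dE / E) / k + 1)%C <> 0) /\
  ((- Ci * (dE / E) / k - 1) / (- Ci * (dE / E) / k + 1) =
   (dE - Ci * k * E) / (dE + Ci * k * E))%C.
Proof.
intros HE Hk HQ; set (u := (- Ci * (dE / E) / k)%C).
assert (Hu : dE = (Ci * k * E * u)%C).
{ unfold u; transitivity (- (Ci * Ci) * dE)%C; [|now field].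
  replace (Ci * Ci)%C with (-(1))%C by (apply injective_projections; simpl; ring); ring. }
assert (HQu : (dE + Ci * k * E)%C = (Ci * k * E * (u + 1))%C) by (rewrite Hu; ring).
assert (HPu : (dE - Ci * k * E)%C = (Ci * k * E * (u - 1))%C) by (rewrite Hu; ring).
assert (Hu1 : (u + 1)%C <> 0).
{ intros H; apply HQ; rewrite HQu, H; ring. }
split; [exact Hu1|]; rewrite HPu, HQu; field.
repeat split; try assumption.
intros H; injection H; lra.
Qed.

Lemma Cexp_neq_0 (s : C) : Cexp s <> 0.
Proof.
intros H; injection H as H1 H2.
pose proof (exp_pos (Re s)); pose proof (sin2_cos2 (Im s)) as H3; unfold Rsqr in H3.
apply Rmult_integral in H1; apply Rmult_integral in H2.
destruct H1 as [H1|H1]; [lra|]; destruct H2 as [H2|H2]; [lra|].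
rewrite H1, H2 in H3; lra.
Qed.

(** The radiation condition gives the flux Re k(L) |E(L)|^2 at L, and Re k(L) < 0. That E(L) <> 0
    follows from backward uniqueness and the nonzero source at z = 0. Monotonicity then carries the
    sign through the layers. *)
Lemma field_flux_neg (c mu0 mu : R) (N : nat) (z : nat -> R) (L : R)
  (eps sigma : R -> R) (o1 o2 : R) (k : R -> C) (h : C) (zs : R) (E dE : R -> C)
  (delta : R) (K lambda : nat -> R) :
  0 < c -> 0 < mu0 -> 0 < mu -> 0 < o1 -> o2 < 0 -> h <> 0 ->
  layered_medium N z L eps sigma ->
  field_solution c mu0 mu N z L eps sigma (o1, o2) k h zs E dE ->
  condition_A c mu0 L eps sigma o1 o2 ->
  condition_B c mu N z eps sigma o1 o2 delta K lambda ->
  Re (k L) < 0 ->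
  forall x, 0 <= x <= L ->
  flux (fun x => Re (E x)) (fun x => Im (E x)) (fun x => Re (dE x)) (fun x => Im (dE x)) x < 0.
Proof.
intros Hc Hmu0 Hmu H1 H2 Hh HM HE HA HB HkL.
assert (Hsys := fun j Hj => layer_system_of_medium c mu0 mu N z L eps sigma o1 o2 k h zs
  E dE delta K lambda j Hc Hmu0 Hmu H1 H2 HM HE HA HB Hj).
assert (Hrad := fs_radiation _ _ _ _ _ _ _ _ _ _ _ _ _ _ HE).
assert (R1 : Re (dE L) = - (Im (k L) * Re (E L) + Re (k L) * Im (E L))).
{ apply (f_equal Re) in Hrad; simpl in Hrad; unfold Re, Im in *; lra. }
assert (R2 : Im (dE L) = Re (k L) * Re (E L) - Im (k L) * Im (E L)).
{ apply (f_equal Im) in Hrad; simpl in Hrad; unfold Re, Im in *; lra. }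
assert (HEL : 0 < Re (E L) ^ 2 + Im (E L) ^ 2).
{ apply Rnot_le_lt; intros Hle.
  assert (HEz : Re (E L) = 0 /\ Im (E L) = 0).
  { destruct (sum_squares_zero (Re (E L)) (Im (E L)) 0 0) as [Hz1 [Hz2 _]]; [lra|now split]. }
  destruct HEz as [Z1 Z2]; rewrite Z1, Z2 in R1, R2.
  assert (H0L : 0 <= L).
  { destruct (layer_bounds _ _ _ _ _ HM 1%nat) as [G1 G2]; [|lra].
    split; [lia|apply (lm_N _ _ _ _ _ HM)]. }
  assert (HZ : Re (E 0) = 0 /\ Im (E 0) = 0 /\ Re (dE 0) = 0 /\ Im (dE 0) = 0).
  { apply (backward_layer_ind N z L eps sigma
      (fun x => Re (E x) = 0 /\ Im (E x) = 0 /\ Re (dE x) = 0 /\ Im (dE x) = 0) HM).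
    - rewrite R1, R2; repeat split; try assumption; ring.
    - intros j Hj [G1 [G2 [G3 G4]]] x Hx; destruct (Hsys j Hj) as [s1b [s2b Hs]].
      exact (layer_zero_field _ _ _ _ _ _ _ _ _ _ _ Hs G1 G2 G3 G4 x Hx).
    - lra. }
  destruct HZ as [G1 [G2 [G3 G4]]].
  assert (HE0 : E 0 = RtoC 0) by now apply injective_projections.
  assert (HdE0 : dE 0 = RtoC 0) by now apply injective_projections.
  assert (Hsrc := fs_source _ _ _ _ _ _ _ _ _ _ _ _ _ _ HE).
  rewrite HE0, HdE0 in Hsrc.
  apply (Cmult_neq_0 h (Cexp (- (Ci * k0 c (o1, o2) * zs)))); [exact Hh|apply Cexp_neq_0|].
  rewrite <- Hsrc; ring. }
apply (backward_layer_ind N z L eps sigma _ HM).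
- unfold flux; rewrite R1, R2.
  replace (_ - _) with (Re (k L) * (Re (E L) ^ 2 + Im (E L) ^ 2)) by ring.
  apply Ropp_lt_cancel; rewrite Ropp_0, Ropp_mult_distr_l.
  apply Rmult_lt_0_compat; lra.
- intros j Hj Hb x Hx; destruct (Hsys j Hj) as [s1b [s2b Hs]].
  exact (Rle_lt_trans _ _ _ (layer_flux_le _ _ _ _ _ _ _ _ _ _ _ Hs x Hx) Hb).
Qed.

(** Passage from the complex w to the real ratio. Negative flux yields both E <> 0 and, with Re k <
    0, the nonvanishing of E' + i k E. *)
Lemma w_spec (L : R) (k E dE : R -> C) (s1 s2 : R -> R) (x : R) :
  x <= L -> s2 x < 0 ->
  Re (k x) = root_re (s1 x) (s2 x) -> Im (k x) = root_im (s1 x) (s2 x) ->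
  flux (fun x => Re (E x)) (fun x => Im (E x)) (fun x => Re (dE x)) (fun x => Im (dE x)) x < 0 ->
  (u L k E dE x + 1)%C <> 0 /\
  Cmod (w L k E dE x) = sqrt (ratio (fun x => Re (E x)) (fun x => Im (E x))
    (fun x => Re (dE x)) (fun x => Im (dE x)) s1 s2 x).
Proof.
intros HxL Hs Hka Hkb HF; unfold w, u, q; destruct (Rle_dec x L); [|lra].
destruct (root_strict (s1 x) _ Hs) as [Ha _].
rewrite <- Hka in Ha; unfold flux in HF.
assert (Hinc := inc_pos (Re (k x)) (Im (k x)) _ _ _ _ (Rlt_le _ _ Ha) HF).
assert (HE : E x <> 0) by (intros H; rewrite H in HF; simpl in HF; lra).
assert (Hk : k x <> 0) by (intros H; rewrite H in Ha; simpl in Ha; lra).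
assert (HQ : Cmod (dE x + Ci * k x * E x) = sqrt (inc (Re (k x)) (Im (k x))
  (Re (E x)) (Im (E x)) (Re (dE x)) (Im (dE x)))).
{ rewrite Cmod_eq_sqrt; f_equal; unfold inc, Re, Im; simpl; ring. }
assert (HP : Cmod (dE x - Ci * k x * E x) = sqrt (refl (Re (k x)) (Im (k x))
  (Re (E x)) (Im (E x)) (Re (dE x)) (Im (dE x)))).
{ rewrite Cmod_eq_sqrt; f_equal; unfold refl, Re, Im; simpl; ring. }
assert (HQ0 : (dE x + Ci * k x * E x)%C <> 0).
{ intros H; rewrite H, Cmod_0 in HQ; pose proof (sqrt_lt_R0 _ Hinc); lra. }
destruct (w_as_quotient (E x) (dE x) (k x) HE Hk HQ0) as [Hu Hw].
split; [exact Hu|].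
rewrite Hw, Cmod_div, HP, HQ by exact HQ0.
unfold ratio; rewrite <- Hka, <- Hkb, sqrt_div_alt by exact Hinc; reflexivity.
Qed.

Lemma kappa_bound (k q : C) (delta : R) :
  let u := (- Ci * q / k)%C in k <> 0 -> (u + 1)%C <> 0 ->
  Cmod ((u - 1) / (u + 1)) <= delta -> delta < 1 ->
  exists kappa : C, k = (- Ci * q * (1 - kappa))%C /\ Cmod kappa <= 2 * delta / (1 - delta).
Proof.
intros u Hk Hu Hw Hd; set (w := ((u - 1) / (u + 1))%C) in *.
assert (Hw1 : (1 - w)%C <> 0).
{ intros H; assert (H1 : w = RtoC 1) by (transitivity (1 - (1 - w))%C; [ring|rewrite H; ring]).
  rewrite H1, Cmod_1 in Hw; lra. }
assert (HwN : 1 - delta <= Cmod (1 + w)).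
{ assert (H := Cmod_triangle (1 + w) (- w)); rewrite Cmod_opp in H.
  replace (1 + w + - w)%C with (RtoC 1) in H by ring; rewrite Cmod_1 in H; lra. }
assert (Hw2 : (1 + w)%C <> 0) by (intros H; rewrite H, Cmod_0 in HwN; lra).
assert (H2 : (1 + 1)%C <> RtoC 0) by (intros H; injection H; lra).
(* u = (1 + w) / (1 - w), so that 1 / u = 1 - kappa for kappa = 2 w / (1 + w) *)
exists ((1 + 1) * w / (1 + w))%C; split.
- assert (Hku : (- Ci * q)%C = (k * u)%C) by (unfold u; now field).
  assert (Huw : (u * (1 - w))%C = (1 + w)%C) by (unfold w; now field).
  rewrite Hku; transitivity (k * (u * (1 - w)) / (1 + w))%C; [rewrite Huw|]; now field.
- rewrite Cmod_div, Cmod_mult by exact Hw2.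
  replace (Cmod (1 + 1)) with 2.
  2: { rewrite <- RtoC_plus, Cmod_R, Rabs_pos_eq; lra. }
  apply Rmult_le_compat.
  + apply Rmult_le_pos; [lra|apply Cmod_ge_0].
  + apply Rlt_le, Rinv_0_lt_compat; lra.
  + lra.
  + apply Rinv_le_contravar; lra.
Qed.

Theorem theorem3p3
  (c mu0 mu : R) (Hc : 0 < c) (Hmu0 : 0 < mu0) (Hmu : 0 < mu)
  (N : nat) (z : nat -> R) (L : R) (eps sigma : R -> R)
  (Hmedium : layered_medium N z L eps sigma)
  (omega1 omega2 : R) (Homega1 : 0 < omega1) (Homega2 : omega2 <= 0)
  (k : R -> C)
  (Hk : forall x : R, 0 <= x ->
     is_wave_root (kz_sq c mu0 mu eps sigma (omega1, omega2) x) (k x))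
  (h : C) (Hh : h <> RtoC 0) (zs : R) (Hzs : zs < 0)
  (E dE : R -> C)
  (HE : field_solution c mu0 mu N z L eps sigma (omega1, omega2) k h zs E dE)
  (HA : condition_A c mu0 L eps sigma omega1 omega2)
  (delta : R) (K lambda : nat -> R)
  (HB : condition_B c mu N z eps sigma omega1 omega2 delta K lambda)
  (HlambdaN : lambda (S N) = 0) (HKN : K (S N) = 1) :
  (* u_j <> -1 on I_j: the quotient defining w_j is a genuine one *)
  (forall (j : nat) (x : R), (1 <= j <= S N)%nat -> layer N z j x ->
     (u L k E dE x + 1)%C <> RtoC 0) /\
  (forall j : nat, (j <= N)%nat ->
     Cmod (w L k E dE (z j)) <= delta /\
     Rbar_le
       (Lub_Rbar (fun r : R => exists x : R,
                    layer N z (S j) x /\ r = Cmod (w L k E dE x)))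
       (1 + lambda (S j) / K (S j))) /\
  (forall j : nat, (1 <= j <= N)%nat ->
     exists l : R,
       filterlim (fun x : R => Cmod (w L k E dE x)) (at_left (z j)) (locally l) /\
       l <= 1) /\
  (forall j : nat, (1 <= j <= N)%nat ->
     exists kappa : C,
       k (z (pred j)) = (- Ci * q L k E dE (z (pred j)) * (1 - kappa))%C /\
       Cmod kappa <= 2 * delta / (1 - delta)).
Proof.
assert (Ho2 : omega2 < 0).
{ destruct HA as [Kc [_ [_ [_ Hu]]]]; pose proof sqrt2_bounds; nra. }
set (s1 := fun x => ksq_re (mu * eps x / c ^ 2) (mu0 * mu * sigma x) omega1 omega2).
set (s2 := fun x => ksq_im (mu * eps x / c ^ 2) (mu0 * mu * sigma x) omega1 omega2).
set (y := ratio (fun x => Re (E x)) (fun x => Im (E x))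
  (fun x => Re (dE x)) (fun x => Im (dE x)) s1 s2).
assert (Hal : forall x, 0 <= x -> 0 < mu * eps x / c ^ 2).
{ intros x Hx; apply Rdiv_lt_0_compat; [|now apply pow_lt].
  apply Rmult_lt_0_compat; [assumption|now apply (lm_eps_pos _ _ _ _ _ Hmedium)]. }
assert (Hbe : forall x, 0 <= x -> 0 <= mu0 * mu * sigma x).
{ intros x Hx; apply Rmult_le_pos; [nra|now apply (lm_sigma_nneg _ _ _ _ _ Hmedium)]. }
assert (Hs2 : forall x, 0 <= x -> s2 x < 0).
{ intros x Hx; apply ksq_im_neg; auto. }
assert (Hkr : forall x, 0 <= x ->
  Re (k x) = root_re (s1 x) (s2 x) /\ Im (k x) = root_im (s1 x) (s2 x)).
{ intros x Hx; destruct (kz_sq_components c mu0 mu eps sigma omega1 omega2 x) as [Q1 Q2].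
  unfold s1, s2; rewrite <- Q1, <- Q2; apply is_wave_root_unique; [|now apply Hk].
  rewrite Q2; now apply Hs2. }
assert (Hk0 : forall x, 0 <= x -> Re (k x) < 0).
{ intros x Hx; rewrite (proj1 (Hkr x Hx)); apply root_strict; auto. }
assert (HzN := lm_zN _ _ _ _ _ Hmedium); assert (HN := lm_N _ _ _ _ _ Hmedium).
assert (HI := interface_le _ _ _ _ _ Hmedium).
assert (HzL : forall j, (j <= N)%nat -> 0 <= z j <= L).
{ intros j Hj; rewrite <- HzN, <- (lm_z0 _ _ _ _ _ Hmedium); split; apply HI; lia. }
assert (HL : 0 <= L) by (rewrite <- HzN; apply HzL; lia).
assert (HF := field_flux_neg c mu0 mu N z L eps sigma omega1 omega2 k h zs E dE delta K lambda
  Hc Hmu0 Hmu Homega1 Ho2 Hh Hmedium HE HA HB (Hk0 L HL)).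
assert (Hw : forall x, 0 <= x <= L -> (u L k E dE x + 1)%C <> 0 /\
  Cmod (w L k E dE x) = sqrt (y x)).
{ intros x Hx; destruct (Hkr x (proj1 Hx)) as [Q1 Q2].
  apply w_spec; [apply Hx|apply Hs2, Hx|exact Q1|exact Q2|now apply HF]. }
assert (Hlast : forall x, L <= x -> u L k E dE x = 1).
{ intros x Hx; assert (Hkx : k x <> 0).
  { intros H; assert (G := Hk0 x ltac:(lra)); rewrite H in G; simpl in G; lra. }
  assert (Hq : q L k E dE x = (Ci * k x)%C).
  (* At x = L the function [q] is still E' / E; the radiation condition shows that it agrees with i
     k there. *)
  { unfold q; destruct (Rle_dec x L) as [HxL|HxL]; [|reflexivity].
    replace x with L by lra.
    assert (Hrad := fs_radiation _ _ _ _ _ _ _ _ _ _ _ _ _ _ HE).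
    assert (HdE : dE L = (Ci * k L * E L)%C).
    { transitivity (dE L - Ci * k L * E L + Ci * k L * E L)%C; [ring|rewrite Hrad; ring]. }
    rewrite HdE; field; intros H; assert (G := HF L ltac:(lra)).
    unfold flux in G; rewrite H in G; simpl in G; lra. }
  unfold u; rewrite Hq.
  transitivity (- (Ci * Ci))%C; [now field|].
  apply injective_projections; simpl; ring. }
assert (Hwlast : forall x, L <= x -> Cmod (w L k E dE x) = 0).
{ intros x Hx; unfold w; rewrite (Hlast x Hx).
  replace ((1 - 1) / (1 + 1))%C with (RtoC 0); [apply Cmod_0|].
  unfold Cdiv; ring. }
destruct HB as [Hdelta HBj]; assert (HB := conj Hdelta HBj).
(* One step of the descent. [w] at [z j] is w_{j+1}(z_j) and at [z (pred j)] it is w_j(z_{j-1}), so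
   the bound by delta moves from one left endpoint to the preceding one. *)
assert (Hstep : forall j, (1 <= j <= N)%nat -> Cmod (w L k E dE (z j)) <= delta ->
  (exists l, filterlim y (at_left (z j)) (locally l) /\ l <= 1) /\
  (forall x, z (pred j) <= x < z j -> y x <= (1 + lambda j / K j) ^ 2) /\
  Cmod (w L k E dE (z (pred j))) <= delta /\ 0 <= lambda j).
{ intros j Hj Hwj.
  destruct (layer_bounds _ _ _ _ _ Hmedium j Hj) as [Hz0 [Hz1 Hz2]].
  destruct (layer_system_of_medium c mu0 mu N z L eps sigma omega1 omega2 k h zs
    E dE delta K lambda j Hc Hmu0 Hmu Homega1 Ho2 Hmedium HE HA HB Hj) as [s1b [s2b Hsys]].
  destruct (HBj j Hj) as [HBx [HKj HBd]].
  assert (Hcone1 := layer_limit_in_cone _ _ _ _ _ _ _ _ _ _ _ Hsys).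
  assert (Hzj : 0 <= z j <= L) by lra.
  (* This is the value on the right of the interface, unlike [Hcone1], which concerns the left
     limit. Condition A holds up to z = L, so j = N is included. *)
  assert (Hcone2 : Rabs (s1 (z j)) <= - s2 (z j)).
  { destruct HA as [Kc [HKc [HKs Hom]]].
    apply (ksq_in_cone _ _ _ _ Kc); auto; [apply Hal, Hzj|apply Hbe, Hzj|].
    assert (He : 0 < eps (z j)) by (apply (lm_eps_pos _ _ _ _ _ Hmedium), Hzj).
    assert (Hp : 0 < mu0 * mu * eps (z j)) by (repeat apply Rmult_lt_0_compat; assumption).
    apply (Rmult_le_reg_r (/ (mu0 * mu * eps (z j)))); [now apply Rinv_0_lt_compat|].
    replace (_ * / _) with (sigma (z j) / eps (z j)) by (field; lra).
    eapply Rle_trans; [now apply HKs|]; apply Req_le; field; lra. }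
  assert (Ha2 : root_re (s1 (z j)) (s2 (z j)) < 0) by apply root_strict, Hs2, Hzj.
  assert (Hincj := inc_pos _ (root_im (s1 (z j)) (s2 (z j))) _ _ _ _ (Rlt_le _ _ Ha2) (HF _ Hzj)).
  assert (Hyj : y (z j) <= delta ^ 2).
  { rewrite (proj2 (Hw _ Hzj)) in Hwj.
    assert (Hy0 : 0 <= y (z j)) by (apply Rdiv_le_0_compat; [apply refl_pos|exact Hincj]).
    rewrite <- (pow2_sqrt _ Hy0); apply pow_incr; split; [apply sqrt_pos|exact Hwj]. }
  assert (HG := layer_ratio_bounds _ _ _ (K j) _ _ _ _ _ _ _ _ Hsys HKj).
  fold s1 s2 y in HG.
  destruct HG as [G1 [G2 G3]].
  - intros x Hx; apply HF; lra.
  - intros x Hx.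
    assert (Hlx : layer N z j x) by (split; [lra|intros _; lra]).
    destruct (HBx x Hlx) as [_ [_ Hrate]].
    assert (Hcx := ls_cone _ _ _ _ _ _ _ _ _ _ _ Hsys x ltac:(lra)).
    fold s1 s2 in Hcx; cbv beta in Hcx.
    assert (Hx0 : 0 <= x) by lra.
    assert (He : 0 < mu * eps x)
      by (apply Rmult_lt_0_compat; [assumption|now apply (lm_eps_pos _ _ _ _ _ Hmedium)]).
    destruct (root_spec (s1 x) (s2 x)) as [_ [_ [_ Q2]]]; [now apply Rlt_le, Hs2|].
    assert (Him := root_im_lower_bound _ _ _ _ _ _ c (mu * eps x) Hc (Rlt_le _ _ He)
      (root_in_cone _ _ Hcx) Q2 (Hbe x Hx0) Homega1 Homega2 eq_refl).
    lra.
  - apply (refl_le_inc_of_interface _ _ (root_re (s1 (z j)) (s2 (z j)))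
      (root_im (s1 (z j)) (s2 (z j))) _ _ _ _ delta).
    + now apply root_in_cone.
    + now apply root_in_cone.
    + exact Ha2.
    + lra.
    + apply (Rmult_le_compat_r _ _ _ (Rlt_le _ _ Hincj)) in Hyj.
      unfold y, ratio, Rdiv in Hyj; rewrite Rmult_assoc, Rinv_l, Rmult_1_r in Hyj
        by (apply Rgt_not_eq, Hincj); exact Hyj.
  - split; [exact G1|]; split; [exact G2|]; split; [|apply (ls_lam _ _ _ _ _ _ _ _ _ _ _ Hsys)].
    rewrite (proj2 (Hw (z (pred j)) ltac:(lra))), <- (sqrt_pow2 delta) by lra.
    apply sqrt_le_1_alt; lra. }
assert (Hwnode : forall j, (j <= N)%nat -> Cmod (w L k E dE (z j)) <= delta).
(* The induction counts layers from the right, starting at z_N = L, where w vanishes. *)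
{ assert (H : forall m, (m <= N)%nat -> Cmod (w L k E dE (z (N - m)%nat)) <= delta).
  { induction m as [|m IH]; intros Hm.
    - rewrite Nat.sub_0_r, HzN, Hwlast by lra; lra.
    - replace (N - S m)%nat with (pred (N - m)) by lia.
      apply Hstep; [lia|apply IH; lia]. }
  intros j Hj; replace j with (N - (N - j))%nat by lia; apply H; lia. }
split; [|split; [|split]].
- intros j x Hj Hx; destruct (Rle_dec x L) as [HxL|HxL].
  + apply Hw; split; [|exact HxL].
    destruct Hx as [Hx _]; assert (H := HzL (pred j) ltac:(lia)); lra.
  + rewrite Hlast by lra; intros H; injection H; lra.
- intros j Hj; split; [now apply Hwnode|].
  apply Lub_Rbar_correct; intros r [x [[Hx1 Hx2] ->]]; simpl in Hx1; simpl.
  destruct (Nat.eq_dec j N) as [->|Hne].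
  + rewrite HlambdaN, HKN, Hwlast by lra; lra.
  + assert (Hj' : (1 <= S j <= N)%nat) by lia; specialize (Hx2 (proj2 Hj')).
    destruct (Hstep (S j) Hj' (Hwnode _ (proj2 Hj'))) as [_ [G [_ Hlam]]].
    destruct (HBj (S j) Hj') as [_ [HKj _]].
    assert (H0 := HzL j Hj); assert (H1 := HzL (S j) (proj2 Hj')).
    rewrite (proj2 (Hw x ltac:(lra))).
    assert (Hr : 0 <= lambda (S j) / K (S j)) by (apply Rdiv_le_0_compat; lra).
    rewrite <- (sqrt_pow2 (1 + _)) by lra.
    apply sqrt_le_1_alt, G; simpl; lra.
- intros j Hj; destruct (Hstep j Hj (Hwnode _ (proj2 Hj))) as [[l [G1 G2]] _].
  destruct (layer_bounds _ _ _ _ _ Hmedium j Hj) as [Hz0 [Hz1 Hz2]].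
  exists (sqrt l); split.
  + apply (filterlim_ext_loc (fun x => sqrt (y x))); [|now apply filterlim_sqrt; [apply at_left_proper_filter|]].
    generalize (at_left_interval _ _ Hz1); apply filter_imp; intros x Hx.
    symmetry; apply Hw; lra.
  + rewrite <- sqrt_1; now apply sqrt_le_1_alt.
- intros j Hj; destruct (layer_bounds _ _ _ _ _ Hmedium j Hj) as [Hz0 [Hz1 Hz2]].
  assert (Hz : 0 <= z (pred j) <= L) by lra.
  assert (Hd := Hwnode (pred j) ltac:(lia)).
  set (x := z (pred j)) in *.
  assert (Hkx : k x <> 0).
  { intros H; assert (G := Hk0 x (proj1 Hz)); rewrite H in G; simpl in G; lra. }
  apply kappa_bound; [exact Hkx|apply Hw, Hz|exact Hd|].
  pose proof sqrt2_bounds; lra.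
Qed.
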